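(* Let $(A+\gamma I),(B+\mu I)\in\mathscr{PC}_2(\mathcal{H})$ and let $\Lambda+\frac{\gamma}{\mu}I=(B+\mu I)^{-1/2}(A+\gamma I)(B+\mu I)^{-1/2}$. Let $\alpha>0,\beta>0$ be fixed. Let $p,q\in\mathbb{R}$ be such that $p\alpha(\gamma/\mu)^p=q\beta(\gamma/\mu)^{-q}$. Then $$\frac{\alpha[(A+\gamma I)(B+\mu I)^{-1}]^p+\beta[(A+\gamma I)(B+\mu I)^{-1}]^{-q}}{\alpha+\beta}\in\mathrm{Tr}_X(\mathcal{H}).$$ Furthermore, $$\det{}_X\left[\frac{\alpha[(A+\gamma I)(B+\mu I)^{-1}]^p+\beta[(A+\gamma I)(B+\mu I)^{-1}]^{-q}}{\alpha+\beta}\right]=\det{}_X\left[\frac{\alpha(\Lambda+\frac{\gamma}{\mu}I)^p+\beta(\Lambda+\frac{\gamma}{\mu}I)^{-q}}{\alpha+\beta}\right].$$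
   Context: $\mathcal{H}$ is a real separable Hilbert space with $\dim\mathcal{H}=\infty$, $I$ its identity operator; $\mathcal{L}(\mathcal{H})$, $\mathrm{Tr}(\mathcal{H})$, $\mathrm{HS}(\mathcal{H})$ are the bounded, trace class and Hilbert-Schmidt operators. $\mathrm{Tr}_X(\mathcal{H})=\{A+\gamma I:A\in\mathrm{Tr}(\mathcal{H}),\gamma\in\mathbb{R}\}$. An operator $T$ is positive definite, $T>0$, if $T=T^*$ and there is $M>0$ with $\langle x,Tx\rangle\ge M\|x\|^2$ for all $x$. $\mathscr{PC}_2(\mathcal{H})=\{A+\gamma I>0:A=A^*,A\in\mathrm{HS}(\mathcal{H}),\gamma\in\mathbb{R}\}$ (necessarily $\gamma>0$). For $P\in\mathscr{PC}_2(\mathcal{H})$, $\log P$ is defined by the spectral calculus and $P^s=\exp(s\log P)$, $s\in\mathbb{R}$. If $T=CPC^{-1}$ with $P\in\mathscr{PC}_2(\mathcal{H})$ and $C\in\mathcal{L}(\mathcal{H})$ invertible, then $\log T=C\log(P)C^{-1}$ and $T^s=\exp(s\log T)=CP^sC^{-1}$; this applies to $(A+\gamma I)(B+\mu I)^{-1}=(B+\mu I)^{1/2}(\Lambda+\frac{\gamma}{\mu}I)(B+\mu I)^{-1/2}$. Extended Fredholm determinant: for $A+\gamma I\in\mathrm{Tr}_X(\mathcal{H})$, $\gamma\ne0$, $\det_X(A+\gamma I)=\gamma\det(A/\gamma+I)$, with $\det$ the Fredholm determinant. *)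

(* Defs.v *)
(* Operators are plain functions [H -> H], with the pointwise vector space
   structure on functions; boundedness is the predicate [bounded_op]. *)
From HB Require Import structures.
From mathcomp Require Import all_boot all_order all_algebra.
From mathcomp Require Import all_classical all_reals all_analysis.

Set Implicit Arguments.
Unset Strict Implicit.
Unset Printing Implicit Defensive.
Import Order.TTheory GRing.Theory Num.Theory.
Import numFieldNormedType.Exports.

Local Open Scope classical_set_scope.
Local Open Scope ring_scope.

Definition separable (T : topologicalType) : Prop :=
  exists2 S : set T, countable S & dense S.

Definition infinite_dimensional (R : realType) (V : lmodType R) : Prop :=
  forall (n : nat) (v : 'I_n -> V),
    exists x : V, forall c : 'I_n -> R, x <> \sum_(i < n) c i *: v i.

Section Operators.
Context {R : realType} {H : completeNormedModType R}.
Variable ip : {dot H for idfun}.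
Implicit Types (A B C D L P S T : H -> H) (e : nat -> H).

Definition hilbert_norm : Prop := forall x : H, `|x| ^+ 2 = ip x x.

Definition bounded_op T : Prop := linear T /\ continuous T.

Definition adjoint_of T S : Prop := forall x y : H, ip (T x) y = ip x (S y).

Definition self_adjoint T : Prop := adjoint_of T T.

(* Countably infinite families only: this is the form taken by every
   orthonormal basis of a separable space of infinite dimension. *)
Definition orthonormal_basis e : Prop :=
  (forall i j : nat, ip (e i) (e j) = (i == j)%:R) /\
  (forall x : H, (forall i : nat, ip x (e i) = 0) -> x = 0).

(* The sum below does not depend on the basis. *)
Definition hilbert_schmidt A : Prop :=
  bounded_op A /\
  exists2 e : nat -> H, orthonormal_basis e &
    cvgn (series (fun k : nat => `|A (e k)| ^+ 2)).

(* S = |A| = (A^* A)^{1/2} *)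
Definition abs_op A S : Prop :=
  [/\ bounded_op S, self_adjoint S, forall x : H, 0 <= ip x (S x) &
      exists2 A' : H -> H, adjoint_of A A' & S \o S = A' \o A].

(* The sum below is tr |A|; it does not depend on the basis. *)
Definition trace_class A : Prop :=
  bounded_op A /\
  exists S : H -> H, abs_op A S /\
    exists2 e : nat -> H, orthonormal_basis e &
      cvgn (series (fun k : nat => ip (e k) (S (e k)))).

Definition pos_def T : Prop :=
  [/\ bounded_op T, self_adjoint T &
      exists2 M : R, 0 < M & forall x : H, M * `|x| ^+ 2 <= ip x (T x)].

(* A + gamma I belongs to PC_2(H), with A its Hilbert-Schmidt part. *)
Definition PC2_of A (gamma : R) : Prop :=
  [/\ hilbert_schmidt A, self_adjoint A & pos_def (A + gamma *: idfun)].

Definition PC2 : set (H -> H) :=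
  [set P | exists A (gamma : R), PC2_of A gamma /\ P = A + gamma *: idfun].

Definition TrX : set (H -> H) :=
  [set T | exists A (gamma : R), trace_class A /\ T = A + gamma *: idfun].

(* f(P) = sum_k f(lambda_k) e_k (x) e_k for P = sum_k lambda_k e_k (x) e_k. By
   the spectral theorem every element of PC2 (a multiple of the identity plus a
   compact self-adjoint operator) has such an expansion. *)
Definition spectral_value (f : R -> R) P T : Prop :=
  bounded_op T /\
  exists e (lambda : nat -> R),
    [/\ orthonormal_basis e,
        forall k : nat, P (e k) = lambda k *: e k &
        forall k : nat, T (e k) = f (lambda k) *: e k].

Definition spectral_fun (f : R -> R) P : H -> H :=
  xget 0 [set T | spectral_value f P T].

Definition inverse_of C D : Prop :=
  [/\ bounded_op C, bounded_op D, C \o D = idfun & D \o C = idfun].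

Definition op_inv C : H -> H := xget 0 [set D | inverse_of C D].

(* log (C P C^{-1}) = C (log P) C^{-1} for P in PC2, with log P given by the
   spectral calculus; C = I covers the elements of PC2 themselves. The value
   depends only on C P C^{-1}. *)
Definition op_log T : H -> H :=
  xget 0 [set L | exists C D P,
    [/\ inverse_of C D, PC2 P, T = C \o P \o D &
        L = C \o spectral_fun (@ln R) P \o D]].

(* sum_n T^n / n!; for bounded T the series converges in operator norm, hence
   its sum can be evaluated pointwise. *)
Definition op_exp T : H -> H :=
  fun x => limn (series (fun n : nat => (n`!%:R : R)^-1 *: iter n T x)).

Definition op_pow T (s : R) : H -> H := op_exp (s *: op_log T).

(* det (I + A), as the limit of the determinants of the finite sections
   P_n (I + A) P_n. The n-th one is the sum over J included in {0, .., n-1} of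
   the principal minors det (<e_i, A e_j>)_(i, j in J), so for trace class A the
   limit is the Fredholm series sum_k Tr (Lambda^k A), whatever the basis. *)
Definition fredholm_det A : R :=
  xget 0 [set d | forall e, orthonormal_basis e ->
    (fun n : nat => \det (\matrix_(i < n, j < n)
       ((i == j)%:R + ip (e i) (A (e j))))) @ \oo --> d].

(* The decomposition T = A + gamma I is unique in infinite dimension. *)
Definition detX T : R :=
  xget 0 [set d | exists A (gamma : R),
    [/\ trace_class A, gamma != 0, T = A + gamma *: idfun &
        d = gamma * fredholm_det (gamma^-1 *: A)]].

End Operators.

(* Main.v *)
(* Write P = Lambda + (gamma/mu) I and C = (B + mu I)^{1/2}, so that
   (A + gamma I)(B + mu I)^{-1} = C P C^{-1}. In an orthonormal eigenbasis (e_k)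
   of P, with P e_k = exp(l_k) e_k, the mean of P is diagonal with entries
   g(l_k); the condition on p and q says that the derivative of g vanishes at
   log(gamma/mu), so g(l_k) - g(log(gamma/mu)) = O((exp(l_k) - gamma/mu)^2) is
   summable. Hence the mean of P is g0 I + K with K diagonal and trace class,
   and the mean of C P C^{-1} is g0 I + C K C^{-1}, where C K C^{-1} is trace
   class as a product of two Hilbert-Schmidt operators.
   The finite sections of I + C K C^{-1} in an arbitrary basis are I plus sums of
   the rank one matrices w_j a_j b_j^T, where K e_j = w_j e_j, a_j = C e_j and
   b_j = C^{-1} e_j. Truncated at j < m, their determinants tend to
   \prod_(j < m) (1 + w_j), because <b_i, a_j> = delta_ij; the truncation error
   is uniformly small by the bound det(1 + Z)^2 <= exp(2 tr Z + |Z|_F^2), which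
   follows from Hadamard's inequality. The limit does not involve C. *)

(* Conjugation by C is not orthogonal: it neither preserves orthonormal bases nor commutes with
   compression to the span of the first n basis vectors, so the finite sections of C K C^{-1} need
   not be similar to those of K. This is why the comparison passes through the products \prod_(j <
   m) (1 + w_j): they approximate both families of sections in every basis, so the predicates from
   which [fredholm_det] selects its value coincide. [spectral_fun], [op_inv], [op_log] and [detX]
   are choices made by [xget], so each value that is computed must also be shown unique. For the
   logarithm this rests on one fact: an operator that intertwines two diagonal operators also
   intertwines their functions. Lambda is given only by its defining equation; that it is
   self-adjoint and Hilbert-Schmidt is derived from the properties of A and B. Adjoints are carried
   as explicit data, and most operators at hand are self-adjoint. *)
Require Import Defs.
From HB Require Import structures.
From mathcomp Require Import all_boot all_order all_algebra.
From mathcomp Require Import all_classical all_reals all_analysis.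
From mathcomp Require Import ring lra.
Set Implicit Arguments.
Unset Strict Implicit.
Unset Printing Implicit Defensive.
Import Order.TTheory GRing.Theory Num.Theory.
Import numFieldNormedType.Exports.
Local Open Scope classical_set_scope.
Local Open Scope ring_scope.

(** * Real inner products *)

Section InnerProduct.
Context {R : realType} {H : completeNormedModType R} (ip : {dot H for idfun}).
Hypothesis ip_norm : hilbert_norm ip.
Implicit Types x y z : H.

Lemma ipC x y : ip x y = ip y x.
Proof. by rewrite hermC expr0 mul1r. Qed.

Lemma ipDl x y z : ip (x + y) z = ip x z + ip y z.
Proof. exact: linearDl. Qed.

Lemma ipZl (a : R) x y : ip (a *: x) y = a * ip x y.
Proof. exact: linearZl_LR. Qed.

Lemma ipDr x y z : ip x (y + z) = ip x y + ip x z.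
Proof. exact: linearDr. Qed.

Lemma ipZr (a : R) x y : ip x (a *: y) = a * ip x y.
Proof. by rewrite ipC ipZl ipC. Qed.

Lemma ipBl x y z : ip (x - y) z = ip x z - ip y z.
Proof. exact: linearBl. Qed.

Lemma ipBr x y z : ip x (y - z) = ip x y - ip x z.
Proof. exact: linearBr. Qed.

Lemma ip0l x : ip 0 x = 0.
Proof. exact: linear0l. Qed.

Lemma ip0r x : ip x 0 = 0.
Proof. exact: linear0r. Qed.

Lemma ip_suml (I : Type) (r : seq I) (P : pred I) (F : I -> H) x :
  ip (\sum_(i <- r | P i) F i) x = \sum_(i <- r | P i) ip (F i) x.
Proof. exact: linear_sumlz. Qed.

Lemma ip_sumr (I : Type) (r : seq I) (P : pred I) (F : I -> H) x :
  ip x (\sum_(i <- r | P i) F i) = \sum_(i <- r | P i) ip x (F i).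
Proof. exact: linear_sumr. Qed.

Lemma ip_ge0 x : 0 <= ip x x.
Proof. by rewrite -ip_norm sqr_ge0. Qed.

Lemma cauchy_schwarz x y : `|ip x y| <= `|x| * `|y|.
Proof.
have [->|y0] := eqVneq y 0; first by rewrite ip0r !normr0 mulr0.
have yy : 0 < ip y y by rewrite -ip_norm exprn_gt0// normr_gt0.
rewrite -ler_sqr ?nnegrE// ?mulr_ge0// exprMn !ip_norm real_normK ?num_real//.
have := ip_ge0 (x - (ip x y / ip y y) *: y).
rewrite ipBl !ipBr !ipZl !ipZr (ipC y x) => h.
rewrite -ler_pdivrMr// -subr_ge0; move: h; congr (0 <= _).
by field; rewrite gt_eqF.
Qed.

Lemma ip_continuousr x : continuous (fun y => ip x y).
Proof.
have [->|x0] := eqVneq x 0.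
  rewrite (_ : (fun y => ip 0 y) = cst 0); first exact: cst_continuous.
  by apply/funext => y; rewrite ip0l.
move=> y; apply/cvgrPdist_le => _/posnumP[e].
near=> z; rewrite -ipBr; apply: (le_trans (cauchy_schwarz _ _)).
rewrite mulrC -ler_pdivlMr ?normr_gt0//.
near: z; apply: cvgr_dist_le => //.
by rewrite divr_gt0// normr_gt0.
Unshelve. all: by end_near. Qed.

Lemma ip_continuousl x : continuous (fun y => ip y x).
Proof.
rewrite (_ : (fun y => ip y x) = (fun y => ip x y)).
  exact: ip_continuousr.
by apply/funext => z; exact: ipC.
Qed.

Lemma cvg_ipr (T : Type) (F : set_system T) (f : T -> H) x y :
  f @ F --> y -> (fun t => ip x (f t)) @ F --> ip x y.
Proof. by move=> fy; exact: (cvg_comp _ _ fy (@ip_continuousr x y)). Qed.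

Lemma cvg_ipl (T : Type) (F : set_system T) (f : T -> H) x y :
  f @ F --> y -> (fun t => ip (f t) x) @ F --> ip y x.
Proof. by move=> fy; exact: (cvg_comp _ _ fy (@ip_continuousl x y)). Qed.

(* All that is used of an orthonormal family; it allows zero vectors. *)
Definition bessel (u : nat -> H) :=
  forall x n, \sum_(k < n) ip x (u k) ^+ 2 <= ip x x.

Definition orthonormal_seq (u : nat -> H) :=
  forall i j : nat, ip (u i) (u j) = (i == j)%:R.

(** Expand the squared norm of x - \sum_k <x, u_k> u_k. Norms at most 1 are allowed for the sake of
    normalised families in which zero vectors stay zero. *)
Lemma orthogonal_bessel (u : nat -> H) :
  (forall i j : nat, i != j -> ip (u i) (u j) = 0) ->
  (forall i, ip (u i) (u i) <= 1) -> bessel u.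
Proof.
move=> uo u1 x n.
pose c k := ip x (u k).
have := ip_ge0 (x - \sum_(k < n) c k *: u k).
have E : ip x (\sum_(k < n) c k *: u k) = \sum_(k < n) c k ^+ 2.
  by rewrite ip_sumr; apply: eq_bigr => k _; rewrite ipZr expr2.
have F : ip (\sum_(k < n) c k *: u k) (\sum_(k < n) c k *: u k) <=
         \sum_(k < n) c k ^+ 2.
  rewrite ip_suml; apply: ler_sum => i _; rewrite ip_sumr (bigD1 i)//= big1.
    by rewrite addr0 ipZl ipZr mulrA -expr2 ler_piMr// sqr_ge0.
  by move=> j ji; rewrite ipZl ipZr uo ?mulr0// eq_sym.
rewrite ipBl !ipBr (ipC _ x) E -/c => h; rewrite -subr_ge0; apply: (le_trans h).
by lra.
Qed.

Lemma orthonormal_seq_bessel u : orthonormal_seq u -> bessel u.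
Proof.
move=> uo; apply: orthogonal_bessel => [i j ij|i]; rewrite uo ?eqxx//.
by rewrite (negbTE ij).
Qed.

Lemma orthonormal_sum_norm (u : nat -> H) (a : nat -> R) (m n : nat) :
  orthonormal_seq u ->
  `|\sum_(m <= k < n) a k *: u k| ^+ 2 = \sum_(m <= k < n) a k ^+ 2.
Proof.
move=> uo; rewrite ip_norm ip_suml big_seq [RHS]big_seq.
apply: eq_bigr => i im; rewrite ip_sumr (bigD1_seq i) ?iota_uniq//= big1.
  by rewrite addr0 ipZl ipZr uo eqxx mulr1 expr2.
by move=> j ji; rewrite ipZl ipZr uo eq_sym (negbTE ji) !mulr0.
Qed.

Lemma bounded_series_cvg (a : nat -> R) (C : R) : (forall k, 0 <= a k) ->
  (forall n, \sum_(k < n) a k <= C) -> cvgn (series a).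
Proof.
move=> a0 aC; apply: nondecreasing_is_cvgn.
  by apply/nondecreasing_seqP => n; rewrite /series/= big_nat_recr//= lerDl.
exists C => _ [n _ <-]; rewrite /series/= big_mkord; exact: aC.
Qed.

Lemma riesz_fischer (u : nat -> H) (a : nat -> R) (C : R) :
  orthonormal_seq u -> (forall n, \sum_(k < n) a k ^+ 2 <= C) ->
  cvgn (series (fun k => a k *: u k)).
Proof.
move=> uo aC; apply/cauchy_cvgP; apply/cauchy_seriesP => e e0.
have /cauchy_cvgP/cauchy_seriesP : cvgn (series (fun k => a k ^+ 2)).
  by apply: (@bounded_series_cvg _ C) => // k; exact: sqr_ge0.
(* The tolerance is squared because the squared norm of a block of the series is the block of the
   squares. *)
move=> /(_ _ (exprn_gt0 2 e0)); apply: filterS => -[m n] /=.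
rewrite ger0_norm ?sumr_ge0// => [h|k _]; last exact: sqr_ge0.
rewrite -ltr_sqr ?nnegrE// ?ltW//.
by rewrite orthonormal_sum_norm.
Qed.

End InnerProduct.

(** * Bounded operators and diagonal operators *)

Section LinearMaps.
Context {R : realType} {H : completeNormedModType R}.
Implicit Types (S T : H -> H) (x y : H).

Lemma lin0 T : linear T -> T 0 = 0.
Proof.
move=> lT; have := lT 1 0 0; rewrite !scale1r addr0 => h.
by apply: (addrI (T 0)); rewrite -h addr0.
Qed.

Lemma linD T : linear T -> {morph T : x y / x + y}.
Proof. by move=> lT x y; have := lT 1 x y; rewrite !scale1r. Qed.

Lemma linZ T : linear T -> forall a : R, {morph T : x / a *: x}.
Proof. by move=> lT a x; have := lT a x 0; rewrite (lin0 lT) !addr0. Qed.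

Lemma linB T : linear T -> {morph T : x y / x - y}.
Proof. by move=> lT x y; rewrite linD// -[in LHS]scaleN1r linZ// scaleN1r. Qed.

Lemma lin_sum T (I : Type) (r : seq I) (P : pred I) (F : I -> H) :
  linear T -> T (\sum_(i <- r | P i) F i) = \sum_(i <- r | P i) T (F i).
Proof. by move=> lT; apply: big_morph; [exact: linD|exact: lin0]. Qed.

Lemma bounded_opP T : bounded_op T <->
  linear T /\ exists2 K : R, 0 <= K & forall x, `|T x| <= K * `|x|.
Proof.
split=> -[lT cT]; split=> //.
  have := cT 0; rewrite /continuous_at lin0// => /cvgr0Pnorm_le /(_ _ ltr01).
  move=> /nbhs_ballP[d /= d0 dT].
  exists (2 / d) => [|x]; first by rewrite divr_ge0// ltW.
  have [->|x0] := eqVneq x 0; first by rewrite lin0// !normr0 mulr0.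
  have x0' : 0 < `|x| by rewrite normr_gt0.
  (* Scales x to norm d / 2, inside the ball on which T is bounded by 1. *)
  pose c := d / 2 / `|x|.
  have c0 : 0 < c by rewrite !divr_gt0.
  have /dT : ball (0 : H) d (c *: x).
    rewrite -ball_normE/= sub0r normrN normrZ gtr0_norm// /c divfK ?gt_eqF//.
    by rewrite ltr_pdivrMr// ltr_pMr// ltr1n.
  rewrite /= linZ// normrZ gtr0_norm// mulrC -ler_pdivlMr// div1r => h.
  apply: (le_trans h); rewrite /c !invfM !invrK [_^-1 * _]mulrC mulrAC.
  by rewrite le_eqVlt; apply/orP; left; apply/eqP; ring.
move: cT => [K K0 TK] x; apply/cvgrPdist_le => _/posnumP[e].
have K1 : 0 < K + 1 by rewrite ltr_wpDl.
near=> z; rewrite -linB//; apply: (le_trans (TK _)).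
apply: (@le_trans _ _ ((K + 1) * `|x - z|)).
  by rewrite ler_wpM2r// lerDl.
rewrite mulrC -ler_pdivlMr//.
near: z; apply: cvgr_dist_le => //.
by rewrite divr_gt0.
Unshelve. all: by end_near. Qed.

Lemma bounded_op_comp S T : bounded_op S -> bounded_op T -> bounded_op (S \o T).
Proof.
move=> [lS cS] [lT cT]; split; first by move=> a x y; rewrite /= lT lS.
by move=> x; apply: continuous_comp; [exact: cT|exact: cS].
Qed.

Lemma bounded_op_id : bounded_op (idfun : H -> H).
Proof. by split=> // x; exact: cvg_id. Qed.

Lemma bounded_opD S T : bounded_op S -> bounded_op T -> bounded_op (S + T).
Proof.
move=> [lS cS] [lT cT]; split.
  by move=> a x y; rewrite !fctE lS lT scalerDr addrACA.
by move=> x; apply: cvgD; [exact: cS|exact: cT].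
Qed.

Lemma bounded_opZ (a : R) T : bounded_op T -> bounded_op (a *: T).
Proof.
move=> [lT cT]; split.
  by move=> b x y; rewrite !fctE lT scalerDr !scalerA mulrC.
by move=> x; apply: cvgZr; exact: cT.
Qed.

End LinearMaps.

Definition bounded_seq (R : realType) (c : nat -> R) :=
  exists K, forall k, `|c k| <= K.

Section OrthonormalBasis.
Context {R : realType} {H : completeNormedModType R} (ip : {dot H for idfun}).
Hypothesis ip_norm : hilbert_norm ip.
Implicit Types (x y : H) (S T : H -> H) (e : nat -> H) (c d : nat -> R).

Lemma onb_eq e x y : orthonormal_basis ip e ->
  (forall k, ip x (e k) = ip y (e k)) -> x = y.
Proof.
move=> [_ te] xy; apply/eqP; rewrite -subr_eq0; apply/eqP/te => k.
by rewrite ipBl xy subrr.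
Qed.

Lemma onb_bessel e : orthonormal_basis ip e -> bessel ip e.
Proof. by move=> [oe _]; exact: orthonormal_seq_bessel. Qed.

Lemma ip_orthonormal_series e (a : nat -> R) y k : orthonormal_seq ip e ->
  series (fun i => a i *: e i) @ \oo --> y -> ip y (e k) = a k.
Proof.
move=> oe ay; have h := cvg_ipl (x := e k) ip_norm ay.
rewrite -(cvg_lim (@Rhausdorff R) h); apply: cvg_lim; first exact: Rhausdorff.
apply: (@cvg_near_cst _ _ _ _ _ eventually_filter).
exists k.+1 => // n /= kn; rewrite /series/= ip_suml (bigD1_seq k) ?iota_uniq//=.
  rewrite big1 ?addr0 => [|i ik]; first by rewrite ipZl oe eqxx mulr1.
  by rewrite ipZl oe (negbTE ik) mulr0.
by rewrite mem_index_iota.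
Qed.

(** The series converges by Riesz-Fischer, and its limit has the coordinates of x; totality of the
    basis then identifies the two. *)
Lemma onb_expansion e x : orthonormal_basis ip e ->
  series (fun k => ip x (e k) *: e k) @ \oo --> x.
Proof.
move=> oe; have [ho _] := oe.
have cv : cvgn (series (fun k => ip x (e k) *: e k)).
  apply: (riesz_fischer ip_norm ho) => n; exact: onb_bessel.
rewrite {2}(_ : x = limn (series (fun k => ip x (e k) *: e k)))//.
by apply: (onb_eq oe) => k; rewrite (ip_orthonormal_series k ho cv).
Qed.

Arguments onb_expansion {e} x.

Lemma parseval e x y : orthonormal_basis ip e ->
  series (fun k => ip x (e k) * ip y (e k)) @ \oo --> ip x y.
Proof.
move=> oe; have h := cvg_ipr (x := y) ip_norm (onb_expansion x oe).
rewrite (ipC _ x y) (_ : series _ =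
  fun n => ip y (series (fun k => ip x (e k) *: e k) n))//.
apply/funext => n; rewrite /series/= ip_sumr.
by apply: eq_bigr => k _; rewrite ipZr.
Qed.
Arguments parseval {e} x y.

Lemma bounded_op_ext e S T : orthonormal_basis ip e ->
  bounded_op S -> bounded_op T -> (forall k, S (e k) = T (e k)) -> S = T.
Proof.
move=> oe [lS cS] [lT cT] ST; apply/funext => x.
have xe := onb_expansion x oe.
have Sx := cvg_comp _ _ xe (cS x); have Tx := cvg_comp _ _ xe (cT x).
rewrite -(cvg_lim (@norm_hausdorff _ _) Sx) -(cvg_lim (@norm_hausdorff _ _) Tx).
congr (limn _); apply/funext => n; rewrite /series/= !lin_sum//.
by apply: eq_bigr => k _; rewrite !linZ// ST.
Qed.

(** [limn] takes a default value on a divergent series; for bounded [c] the series converges at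
    every x, hence the recurring hypothesis [bounded_seq c]. *)
Definition diag e c : H -> H :=
  fun x => limn (series (fun k => (c k * ip x (e k)) *: e k)).

Lemma diag_bound e c K x n : orthonormal_basis ip e ->
  (forall k, `|c k| <= K) ->
  \sum_(k < n) (c k * ip x (e k)) ^+ 2 <= K ^+ 2 * ip x x.
Proof.
move=> oe cK; apply: (@le_trans _ _ (\sum_(k < n) K ^+ 2 * ip x (e k) ^+ 2)).
  apply: ler_sum => k _; rewrite exprMn ler_wpM2r ?sqr_ge0//.
  by rewrite -[leLHS]real_normK ?num_real// lerXn2r ?nnegrE// (le_trans _ (cK k)).
by rewrite -mulr_sumr ler_wpM2l ?sqr_ge0//; exact: onb_bessel.
Qed.

Lemma diag_cvg e c x : orthonormal_basis ip e -> bounded_seq c ->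
  series (fun k => (c k * ip x (e k)) *: e k) @ \oo --> diag e c x.
Proof.
move=> oe [K cK]; apply: (riesz_fischer ip_norm); first by case: oe.
by move=> n; apply: (diag_bound _ _ oe cK).
Qed.

Arguments diag_cvg {e c} x.

Lemma ip_diag e c x k : orthonormal_basis ip e -> bounded_seq c ->
  ip (diag e c x) (e k) = c k * ip x (e k).
Proof.
move=> oe bc; apply: (ip_orthonormal_series _ _ (diag_cvg x oe bc)).
by case: oe.
Qed.

Lemma diag_linear e c : orthonormal_basis ip e -> bounded_seq c ->
  linear (diag e c).
Proof.
move=> oe bc a x y; apply: (onb_eq oe) => k.
by rewrite ip_diag// !ipDl !ipZl !ip_diag//; ring.
Qed.

Lemma diag_norm e c K x : orthonormal_basis ip e ->
  (forall k, `|c k| <= K) -> `|diag e c x| <= K * `|x|.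
Proof.
move=> oe cK; have K0 : 0 <= K by rewrite (le_trans _ (cK 0)).
rewrite -ler_sqr ?nnegrE ?mulr_ge0// exprMn !ip_norm.
have bc : bounded_seq c by exists K.
have h := parseval (diag e c x) (diag e c x) oe.
rewrite -(cvg_lim (@Rhausdorff R) h); apply: limr_le.
  by apply/cvg_ex; eexists; exact: h.
near=> n; rewrite /series/= big_mkord.
under eq_bigr do rewrite ip_diag// -expr2.
exact: diag_bound.
Unshelve. all: by end_near. Qed.

Lemma diag_bounded e c : orthonormal_basis ip e -> bounded_seq c ->
  bounded_op (diag e c).
Proof.
move=> oe bc; apply/bounded_opP; split; first exact: diag_linear.
case: bc => K cK; exists K; first by rewrite (le_trans _ (cK 0)).
by move=> x; exact: diag_norm.
Qed.

Lemma diag_basis e c k : orthonormal_basis ip e -> bounded_seq c ->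
  diag e c (e k) = c k *: e k.
Proof.
move=> oe bc; apply: (onb_eq oe) => i; rewrite ip_diag// ipZl oe.1.
by case: eqVneq => [->//|_]; rewrite !mulr0.
Qed.

Lemma diag_unique e c T : orthonormal_basis ip e -> bounded_seq c ->
  bounded_op T -> (forall k, T (e k) = c k *: e k) -> T = diag e c.
Proof.
move=> oe bc bT Te; apply: (bounded_op_ext oe bT); first exact: diag_bounded.
by move=> k; rewrite Te diag_basis.
Qed.

Lemma diag_self_adjoint e c : orthonormal_basis ip e -> bounded_seq c ->
  self_adjoint ip (diag e c).
Proof.
move=> oe bc x y.
rewrite -(cvg_lim (@Rhausdorff R) (parseval (diag e c x) y oe)).
rewrite -(cvg_lim (@Rhausdorff R) (parseval x (diag e c y) oe)).
congr (limn _); apply/funext => n; apply: eq_bigr => k _.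
by rewrite !ip_diag//; ring.
Qed.

Lemma bounded_seqM c d : bounded_seq c -> bounded_seq d ->
  bounded_seq (fun k => c k * d k).
Proof.
move=> [K cK] [L dL]; exists (K * L) => k; rewrite normrM.
by apply: ler_pM.
Qed.

Lemma diag_comp e c d : orthonormal_basis ip e -> bounded_seq c ->
  bounded_seq d -> diag e c \o diag e d = diag e (fun k => c k * d k).
Proof.
move=> oe bc bd; apply/funext => x; apply: (onb_eq oe) => k.
by rewrite /= !ip_diag//; [ring|exact: bounded_seqM].
Qed.

Lemma diag1 e : orthonormal_basis ip e -> diag e (fun=> 1) = idfun.
Proof.
move=> oe; have b1 : bounded_seq (fun=> 1 : R) by exists `|1|.
by apply/funext => x; apply: (onb_eq oe) => k; rewrite ip_diag// mul1r.
Qed.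

End OrthonormalBasis.
Arguments onb_expansion {R H ip} ip_norm {e} x.
Arguments parseval {R H ip} ip_norm {e} x y.
Arguments diag_cvg {R H ip} ip_norm {e c} x.

(** * Hilbert-Schmidt operators *)

Lemma cvg_sum (R : realType) (V : normedModType R) (I T : Type)
    (F : set_system T) (r : seq I) (P : pred I) (f : I -> T -> V) (l : I -> V) :
  Filter F -> (forall i, P i -> f i x @[x --> F] --> l i) ->
  \sum_(i <- r | P i) f i x @[x --> F] --> \sum_(i <- r | P i) l i.
Proof. exact: (cvg_big (@add_continuous _)). Qed.

(** Carries an ultrafilter on indices to the real line, where compactness of a segment provides
    limits of coordinates. *)
Lemma ultra_map (T U : Type) (f : T -> U) (F : set_system T) :
  UltraFilter F -> UltraFilter (f @ F).
Proof.
move=> FU; split=> [|G GF sFG]; first exact: fmap_proper_filter.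
rewrite predeqE => A; split; last exact: sFG.
move=> GA; have [//|FnA] := in_ultra_setVsetC (f @^-1` A) FU.
have GnA : G (~` A) by apply: sFG.
by have /filter_ex [? []] : G (A `&` (~` A)) by exact: filterI.
Qed.

Lemma cvg_seq_le (R : realType) (a : nat -> R) (l C : R) :
  a @ \oo --> l -> (forall n, a n <= C) -> l <= C.
Proof.
move=> al aC; rewrite -(cvg_lim (@Rhausdorff R) al); apply: limr_le.
  by apply/cvg_ex; exists l.
by near=> n; exact: aC.
Unshelve. all: by end_near. Qed.
Arguments cvg_seq_le {R a l C}.

Lemma series_le_lim (R : realType) (a : nat -> R) n : (forall k, 0 <= a k) ->
  cvgn (series a) -> \sum_(k < n) a k <= limn (series a).
Proof.
move=> a0 ca.
have := @nondecreasing_cvgn_le R (series a) _ ca n.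
rewrite /series/= big_mkord; apply.
by apply/nondecreasing_seqP => k; rewrite /series/= big_nat_recr//= lerDl.
Qed.

Section HilbertSchmidt.
Context {R : realType} {H : completeNormedModType R} (ip : {dot H for idfun}).
Hypothesis ip_norm : hilbert_norm ip.
Implicit Types (x y : H) (S T X Y : H -> H) (e u : nat -> H) (C : R).

(** A basis-free Hilbert-Schmidt bound. Uniformity over Bessel families makes it stable under sums,
    adjoints and products with bounded operators. *)
Definition hs_bounded X := exists C, forall u, bessel ip u ->
  forall n, \sum_(k < n) `|X (u k)| ^+ 2 <= C.

Lemma adjoint_sym X Y : adjoint_of ip X Y -> adjoint_of ip Y X.
Proof. by move=> XY x y; rewrite ipC -XY ipC. Qed.

(* Both double sums run over |<X e_j, u_k>|^2; Parseval is used in e and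
   Bessel in u. *)
Lemma hs_adjoint_bound e X Y C : orthonormal_basis ip e ->
  adjoint_of ip X Y -> (forall n, \sum_(k < n) `|X (e k)| ^+ 2 <= C) ->
  forall u, bessel ip u -> forall n, \sum_(k < n) `|Y (u k)| ^+ 2 <= C.
Proof.
move=> oe XY eC u bu n.
have cv : (fun N => \sum_(k < n)
    series (fun j => ip (Y (u k)) (e j) * ip (Y (u k)) (e j)) N) @ \oo -->
    \sum_(k < n) `|Y (u k)| ^+ 2.
  apply: cvg_sum => k _.
  by rewrite ip_norm; exact: parseval.
apply: (cvg_seq_le cv) => N; rewrite /series/= exchange_big/= big_mkord.
apply: le_trans (eC N); apply: ler_sum => j _.
rewrite ip_norm; apply: le_trans (bu (X (e j)) n); apply: ler_sum => k _.
by rewrite -expr2 XY ipC.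
Qed.

Lemma hs_bounded_adjoint e X Y : orthonormal_basis ip e ->
  adjoint_of ip X Y -> hs_bounded X -> hs_bounded Y.
Proof.
move=> oe XY [C XC]; exists C; apply: (hs_adjoint_bound oe XY) => n.
exact: (XC _ (onb_bessel ip_norm oe)).
Qed.

(** The bound in one basis passes to Y over all Bessel families, then back to X by taking adjoints
    again. *)
Lemma hilbert_schmidt_bounded X Y : adjoint_of ip X Y ->
  hilbert_schmidt ip X -> hs_bounded X.
Proof.
move=> XY [_ [e oe Xe]].
have h := hs_adjoint_bound oe XY
  (fun n => series_le_lim n (fun k => sqr_ge0 `|X (e k)|) Xe).
apply: hs_bounded_adjoint oe (adjoint_sym XY) _.
by eexists => u bu n; exact: h.
Qed.

Lemma hs_bounded_hilbert_schmidt e X : orthonormal_basis ip e ->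
  bounded_op X -> hs_bounded X -> hilbert_schmidt ip X.
Proof.
move=> oe bX [C XC]; split=> //; exists e => //.
apply: (@bounded_series_cvg _ _ C) => [k|n]; first exact: sqr_ge0.
exact: (XC _ (onb_bessel ip_norm oe)).
Qed.

Lemma hs_bounded_compl S X : bounded_op S -> hs_bounded X -> hs_bounded (S \o X).
Proof.
move=> /bounded_opP[_ [K K0 SK]] [C XC]; exists (K ^+ 2 * C) => u bu n.
apply: (@le_trans _ _ (\sum_(k < n) K ^+ 2 * `|X (u k)| ^+ 2)).
  by apply: ler_sum => k _; rewrite -exprMn lerXn2r ?nnegrE ?mulr_ge0//=.
by rewrite -mulr_sumr ler_wpM2l ?sqr_ge0// XC.
Qed.

Lemma adjoint_comp S S' T T' : adjoint_of ip S S' -> adjoint_of ip T T' ->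
  adjoint_of ip (S \o T) (T' \o S').
Proof. by move=> SS TT x y; rewrite /= SS TT. Qed.

(** S need not map Bessel families to Bessel families, so the factor is moved to the left by
    adjoints: S' \o X' is the adjoint of X \o S. *)
Lemma hs_bounded_compr e X X' S S' : orthonormal_basis ip e ->
  adjoint_of ip X X' -> adjoint_of ip S S' -> bounded_op S' ->
  hs_bounded X -> hs_bounded (X \o S).
Proof.
move=> oe XX SS bS hX; have hX' := hs_bounded_adjoint oe XX hX.
apply: hs_bounded_adjoint oe (adjoint_sym (adjoint_comp XX SS)) _.
exact: hs_bounded_compl.
Qed.

Lemma hs_boundedD X Y : hs_bounded X -> hs_bounded Y -> hs_bounded (X + Y).
Proof.
move=> [C XC] [D YD]; exists (2 * C + 2 * D) => u bu n.
apply: (@le_trans _ _ (\sum_(k < n)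
    (2 * `|X (u k)| ^+ 2 + 2 * `|Y (u k)| ^+ 2))).
  apply: ler_sum => k _.
  apply: (@le_trans _ _ ((`|X (u k)| + `|Y (u k)|) ^+ 2)).
    by rewrite lerXn2r ?nnegrE ?addr_ge0//= ler_normD.
  by have := sqr_ge0 (`|X (u k)| - `|Y (u k)|); nra.
by rewrite big_split/= -!mulr_sumr lerD// ler_pM2l// ?XC ?YD.
Qed.

Lemma hs_boundedZ (a : R) X : hs_bounded X -> hs_bounded (a *: X).
Proof.
move=> [C XC]; exists (a ^+ 2 * C) => u bu n.
under eq_bigr do rewrite fctE normrZ exprMn real_normK ?num_real//.
by rewrite -mulr_sumr ler_wpM2l ?sqr_ge0// XC.
Qed.

Lemma hs_bounded_diag e c C : orthonormal_basis ip e -> bounded_seq c ->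
  (forall n, \sum_(k < n) c k ^+ 2 <= C) -> hs_bounded (diag ip e c).
Proof.
move=> oe bc cC; exists C.
apply: (hs_adjoint_bound oe (diag_self_adjoint ip_norm oe bc)) => n.
under eq_bigr => k _.
  rewrite diag_basis// normrZ exprMn real_normK ?num_real// ip_norm oe.1 eqxx.
  rewrite mulr1; over.
exact: cC.
Qed.

End HilbertSchmidt.

Lemma cvg_to_unique (V : ptopologicalType) (T : Type) (F : set_system T)
    (f : T -> V) (l l' : V) : hausdorff_space V -> ProperFilter F ->
  f @ F --> l -> f @ F --> l' -> l = l'.
Proof. by move=> hV FF fl fl'; rewrite -(cvg_lim hV fl) (cvg_lim hV fl'). Qed.

(** * Eigenvectors of self-adjoint Hilbert-Schmidt operators *)

Section Eigenvector.
Context {R : realType} {H : completeNormedModType R} (ip : {dot H for idfun}).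
Hypothesis ip_norm : hilbert_norm ip.
Implicit Types (x y : H) (A : H -> H) (e : nat -> H) (S : set H) (C : R).

(* Coordinates converge along an ultrafilter, and square summability of
   |A e_k| makes this convergence of A x_n in norm. *)
Lemma hs_compact e A C (x : nat -> H) (U : set_system nat) :
  orthonormal_basis ip e -> bounded_op A ->
  (forall n, \sum_(k < n) `|A (e k)| ^+ 2 <= C) ->
  (forall n, `|x n| <= 1) -> UltraFilter U ->
  exists y, A (x n) @[n --> U] --> y.
Proof.
move=> oe [lA cA] eC x1 UU.
have PU : ProperFilter U by exact: ultra_proper.
have /choice[c xc] k : exists c : R, ip (x n) (e k) @[n --> U] --> c.
  have := @segment_compact R (-1) 1; rewrite compact_ultra.
  have UUk : UltraFilter (ip (x n) (e k) @[n --> U]) by exact: ultra_map.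
  move=> /(_ _ UUk)[|c [_ xc]]; last by exists c.
  rewrite nbhs_filterE/=; apply: filterE => n /=; rewrite in_itv/= -ler_norml.
  apply: (le_trans (cauchy_schwarz ip_norm _ _)).
  have /eqP := oe.1 k k; rewrite eqxx -ip_norm sqrf_eq1 => /orP[/eqP->|/eqP h].
    by rewrite mulr1.
  by have := normr_ge0 (e k); rewrite h; lra.
suff /cauchy_cvgP/cvg_ex[y Axy] : cauchy (A (x n) @[n --> U]) by exists y.
apply: cauchy_exP => d d0.
have ca : cvgn (series (fun k => `|A (e k)| ^+ 2)).
  by apply: (@bounded_series_cvg _ _ C) => // k; exact: sqr_ge0.
have d20 : 0 < d / 2 by rewrite divr_gt0.
have /cauchy_cvgP/cauchy_seriesP/(_ _ (exprn_gt0 2 d20)) := ca.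
move=> [[P Q] /= [[N1 _ NP] [N2 _ NQ]] PQ].
pose N := maxn N1 N2.
have tail n : (N <= n)%N -> \sum_(N <= k < n) `|A (e k)| ^+ 2 <= (d / 2) ^+ 2.
  move=> Nn; have := PQ (N, n); rewrite /= ger0_norm.
    move=> h; apply/ltW/h; split; [apply: NP|apply: NQ] => /=.
      exact: leq_maxl.
    by apply: leq_trans Nn; exact: leq_maxr.
  by apply: sumr_ge0 => k _; exact: sqr_ge0.
(* Limit along U of the images of the first N terms of x_n; the images of the remainders are at most
   d / 2 in norm, uniformly in n. *)
pose y := \sum_(k < N) c k *: A (e k).
have yc : \sum_(k < N) ip (x n) (e k) *: A (e k) @[n --> U] --> y.
  by apply: cvg_sum => k _; apply: cvgZl; exact: xc.
exists y; rewrite nbhs_filterE/=.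
move/cvgrPdist_lt : yc => /(_ _ d20); apply: filterS => n yn.
rewrite -ball_normE/=.
have -> : y - A (x n) = (y - \sum_(k < N) ip (x n) (e k) *: A (e k)) -
    (A (x n) - \sum_(k < N) ip (x n) (e k) *: A (e k)).
  by rewrite opprB addrA subrK.
rewrite (splitr d); apply: (le_lt_trans (ler_normB _ _)); apply: ltr_leD => //.
have cv : A (series (fun k => ip (x n) (e k) *: e k) m) -
    \sum_(k < N) ip (x n) (e k) *: A (e k) @[m --> \oo] -->
    A (x n) - \sum_(k < N) ip (x n) (e k) *: A (e k).
  apply: cvgB; last exact: cvg_cst.
  have h := cvg_comp _ _ (onb_expansion ip_norm (x n) oe) (cA (x n)).
  exact: h.
move/cvg_norm : cv => cv.
rewrite -(cvg_lim (@Rhausdorff R) cv); apply: limr_le.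
  by apply/cvg_ex; eexists; exact: cv.
near=> m; have Nm : (N <= m)%N by near: m; exists N.
rewrite /series/= (@big_cat_nat _ _ _ N)//= linD//.
have -> : A (\sum_(0 <= k < N) ip (x n) (e k) *: e k) =
    \sum_(k < N) ip (x n) (e k) *: A (e k).
  by rewrite big_mkord lin_sum//; apply: eq_bigr => k _; rewrite linZ.
rewrite addrAC subrr add0r lin_sum//.
apply: (le_trans (ler_norm_sum _ _ _)).
(* Weighted AM-GM. As the two square sums are at most 1 and (d / 2)^2, each half contributes at most
   d / 4. *)
apply: (@le_trans _ _ (\sum_(N <= k < m)
    (ip (x n) (e k) ^+ 2 * (d / 4) + `|A (e k)| ^+ 2 / d))).
  apply: ler_sum => k _; rewrite linZ// normrZ.
  rewrite -[ip _ _ ^+ 2]real_normK ?num_real//.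
  set a := `|_|; set b := `|_|.
  have -> : a ^+ 2 * (d / 4) + b ^+ 2 / d = a * b + (a * d / 2 - b) ^+ 2 / d.
    by field; rewrite gt_eqF.
  by rewrite lerDl divr_ge0// ?sqr_ge0// ltW.
rewrite big_split/= -!mulr_suml.
have h1 : \sum_(N <= k < m) ip (x n) (e k) ^+ 2 <= 1.
  apply: (@le_trans _ _ (\sum_(k < m) ip (x n) (e k) ^+ 2)).
    rewrite -(big_mkord xpredT (fun k => ip (x n) (e k) ^+ 2)).
    rewrite [leRHS](@big_cat_nat _ _ _ N)//= lerDr.
    by apply: sumr_ge0 => k _; exact: sqr_ge0.
  apply: (le_trans (onb_bessel ip_norm oe _ _)).
  by rewrite -ip_norm exprn_ile1.
have h2 := tail _ Nm.
apply: (@le_trans _ _ (1 * (d / 4) + (d / 2) ^+ 2 / d)).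
  apply: lerD; first by rewrite ler_wpM2r// divr_ge0// ltW.
  by rewrite ler_wpM2r// invr_ge0 ltW.
by rewrite le_eqVlt; apply/orP; left; apply/eqP; field; rewrite gt_eqF.
Unshelve. all: by end_near. Qed.

(** A preserves the orthogonal complement M of the eigenvectors in S. Let m be the supremum of |A x|
    over unit x in M, attained in the limit by x_n. The limit y of A x_n along an ultrafilter
    satisfies A (A y) = m^2 y, and A^2 - m^2 = (A - m) (A + m) yields an eigenvector for m or -m. *)
Lemma hs_eigenvector e A C S x0 : orthonormal_basis ip e -> bounded_op A ->
  self_adjoint ip A -> (forall n, \sum_(k < n) `|A (e k)| ^+ 2 <= C) ->
  (forall u, S u -> exists l : R, A u = l *: u) ->
  x0 != 0 -> (forall u, S u -> ip x0 u = 0) ->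
  exists v (l : R), [/\ `|v| = 1, forall u, S u -> ip v u = 0 & A v = l *: v].
Proof.
move=> oe bA sA eC SA x00 Sx0; have [lA cA] := bA.
pose M : set H := [set x | forall u, S u -> ip x u = 0].
have MZ a x : M x -> M (a *: x) by move=> Mx u Su; rewrite ipZl Mx ?mulr0.
have MD x y : M x -> M y -> M (x + y).
  by move=> Mx My u Su; rewrite ipDl Mx ?My ?addr0.
have MA x : M x -> M (A x).
  by move=> Mx u Su; have [l Au] := SA u Su; rewrite sA Au ipZr Mx ?mulr0.
suff [v [l [v0 Mv Av]]] : exists v l, [/\ v != 0, M v & A v = l *: v].
  exists (`|v|^-1 *: v), l; split.
  - by rewrite normrZ normfV normr_id mulVf// normr_eq0.
  - exact: MZ.
  - by rewrite linZ// Av !scalerA mulrC.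
have [_ [K K0 AK]] := (bounded_opP A).1 bA.
pose E := [set `|A x| | x in [set x | M x /\ `|x| = 1]].
pose x1 := `|x0|^-1 *: x0.
have Mx1 : M x1 by exact: MZ.
have x11 : `|x1| = 1 by rewrite normrZ normfV normr_id mulVf// normr_eq0.
have supE : has_sup E.
  split; first by exists `|A x1|; exists x1.
  by exists K => _ [x [_ x1e] <-]; rewrite (le_trans (AK _))// x1e mulr1.
pose m := sup E.
have Am x : M x -> `|A x| <= m * `|x|.
  move=> Mx; have [->|xn0] := eqVneq x 0; first by rewrite lin0// !normr0 mulr0.
  have xp : 0 < `|x| by rewrite normr_gt0.
  rewrite -ler_pdivrMr// mulrC.
  have -> : `|x|^-1 * `|A x| = `|A (`|x|^-1 *: x)|.
    by rewrite linZ// normrZ normfV normr_id.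
  apply: (ub_le_sup supE.2); exists (`|x|^-1 *: x) => //; split; first exact: MZ.
  by rewrite normrZ normfV normr_id mulVf// gt_eqF.
have m0 : 0 <= m by have := Am _ Mx1; rewrite x11 mulr1; exact: le_trans.
have [m_eq0|m_neq0] := eqVneq m 0.
  exists x0, 0; split=> //.
  by apply/eqP; rewrite scale0r -normr_le0 (le_trans (Am _ Sx0))// m_eq0 mul0r.
have mp : 0 < m by rewrite lt_neqAle eq_sym m_neq0.
have /choice[x xP] (n : nat) :
    exists x, [/\ M x, `|x| = 1 & m - n.+1%:R^-1 < `|A x|].
  have n0 : 0 < n.+1%:R^-1 :> R by rewrite invr_gt0.
  have [_ [x [Mx x1e] <-] h] := sup_adherent n0 supE.
  by exists x.
have [U [UU ooU]] := ultraFilterLemma eventually_filter.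
have PU : ProperFilter U by exact: ultra_proper.
have [|y Axy] := @hs_compact e A C x U oe bA eC _ UU.
  by move=> n; have [_ -> _] := xP n.
have normA : `|A (x n)| @[n --> U] --> m.
  apply: (@cvg_trans _ (`|A (x n)| @[n --> \oo])).
    by move=> P /ooU.
  apply: (@squeeze_cvgr _ _ _ _ (fun n => m - n.+1%:R^-1) (cst m)).
  - near=> n; have [Mx xn h] := xP n; rewrite ltW//=.
    by have := Am _ Mx; rewrite xn mulr1.
  - rewrite -[X in _ --> X]subr0; apply: cvgB; first exact: cvg_cst.
    exact: cvg_harmonic.
  - exact: cvg_cst.
have ym : `|y| = m.
  have h : `|A (x n)| @[n --> U] --> `|y| by exact: cvg_norm.
  exact: (cvg_to_unique (@Rhausdorff R) _ h normA).
have My : M y.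
  move=> u Su; have h := cvg_ipl (x := u) ip_norm Axy.
  apply: (cvg_to_unique (@Rhausdorff R) _ h).
  rewrite (_ : (fun n => _) = cst 0); first exact: cvg_cst.
  by apply/funext => n; have [Mx _ _] := xP n; rewrite MA.
have AAy : A (A y) = m ^+ 2 *: y.
  (* Since |A (A x_n)| <= m |A x_n|, the squared norm is at most m^2 (m^2 - |A x_n|^2), which tends
     to 0. *)
  have AAx : A (A (x n)) - m ^+ 2 *: x n @[n --> U] --> (0 : H).
    apply/cvgr0Pnorm_le => _/posnumP[d].
    have /cvgrPdist_le : `|A (x n)| ^+ 2 @[n --> U] --> m ^+ 2.
      by rewrite !expr2; under eq_fun do rewrite expr2; exact: cvgM.
    have d0 : 0 < (d%:num / m) ^+ 2 by rewrite exprn_gt0// divr_gt0.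
    move=> /(_ _ d0); apply: filterS => n; have [Mx xn h] := xP n.
    have mx : `|A (x n)| <= m by have := Am _ Mx; rewrite xn mulr1.
    rewrite ger0_norm; last by rewrite subr_ge0 lerXn2r ?nnegrE.
    rewrite exprMn exprVn => mA.
    rewrite -ler_sqr ?nnegrE// ip_norm ipBl !ipBr !ipZl !ipZr (ipC _ (x n)).
    rewrite (sA (A (x n)) (x n)) -!ip_norm xn.
    have hA : `|A (A (x n))| ^+ 2 <= m ^+ 2 * `|A (x n)| ^+ 2.
      by rewrite -exprMn lerXn2r ?nnegrE ?mulr_ge0// Am//; exact: MA.
    move: mA; rewrite ler_pdivlMr ?exprn_gt0// => mA.
    rewrite expr1n; apply: le_trans mA; move: hA.
    set a := `|A (A (x n))|; set b := `|A (x n)|.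
    by nra.
  (* Nothing says that x_n converges; one more application of A replaces it by A x_n, which does. *)
  have c1 : A (A (A (x n)) - m ^+ 2 *: x n) @[n --> U] --> A 0.
    exact: (cvg_comp _ _ AAx (cA 0)).
  have c2 : A (A (A (x n))) @[n --> U] --> A (A y).
    exact: (cvg_comp _ _ (cvg_comp _ _ Axy (cA _)) (cA _)).
  have c3 : m ^+ 2 *: A (x n) @[n --> U] --> m ^+ 2 *: y by exact: cvgZr.
  have c4 : A (A (A (x n))) - m ^+ 2 *: A (x n) @[n --> U] -->
    A (A y) - m ^+ 2 *: y by exact: cvgB.
  apply/eqP; rewrite -subr_eq0; apply/eqP.
  apply: (cvg_to_unique (@norm_hausdorff _ H) PU c4).
  rewrite -[X in _ --> X](lin0 lA).
  rewrite (_ : (fun n => _) = fun n => A (A (A (x n)) - m ^+ 2 *: x n))//.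
  by apply/funext => n; rewrite (linB lA) (linZ lA).
have y0 : y != 0 by rewrite -normr_eq0 ym.
have [Ay|Ay] := eqVneq (A y + m *: y) 0.
  exists y, (- m); split=> //.
  by apply/eqP; rewrite scaleNr -subr_eq0 opprK Ay.
exists (A y + m *: y), m; split=> //; first by apply: MD; [exact: MA|exact: MZ].
by rewrite linD// linZ// AAy scalerDr scalerA expr2 addrC.
Unshelve. all: by end_near. Qed.

End Eigenvector.

(** * Spectral theorem *)

Section SpectralTheorem.
Context {R : realType} {H : completeNormedModType R} (ip : {dot H for idfun}).
Hypothesis ip_norm : hilbert_norm ip.
Hypothesis sepH : separable H.
Hypothesis dimH : infinite_dimensional H.
Implicit Types (x y : H) (A : H -> H) (e : nat -> H) (S : set H).

Definition orthonormal_set S := (forall u, S u -> `|u| = 1) /\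
  (forall u v, S u -> S v -> u <> v -> ip u v = 0).

(** Distinct members are at distance sqrt 2, so balls of radius 1/2 around them pick distinct points
    of a countable dense set. *)
Lemma orthonormal_set_countable S : orthonormal_set S -> countable S.
Proof.
move=> [S1 S0]; have [D Dc Dd] := sepH.
have /choice[f fP] (u : H) : exists d, D d /\ ball u 2^-1 d.
  have [|d [ud Dd']] := Dd (ball u 2^-1) _ (ball_open _ _).
    by exists u; exact: ballxx.
  by exists d.
apply: (@card_le_trans _ _ _ D) => //.
apply/pcard_leP/injfunPex; exists f.
  by move=> u _; have [] := fP u.
move=> u v /set_mem Su /set_mem Sv fuv; apply: contrapT => uv.
have [_] := fP u; have [_] := fP v; rewrite -fuv -!ball_normE/= => hv hu.
have : `|u - v| < 1.
  rewrite (_ : u - v = (u - f u) - (v - f u)); last by rewrite opprB addrA subrK.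
  apply: (le_lt_trans (ler_normB _ _)); lra.
rewrite -(@ltr_sqr _ `|u - v|) ?nnegrE// ip_norm ipBl !ipBr -!ip_norm (ipC _ v u).
by rewrite S0// !S1//; lra.
Qed.

(** If S were finite, every x would equal its projection on the span of S, as the difference is
    orthogonal to S; this contradicts [dimH]. *)
Lemma total_orthonormal_set_infinite S : orthonormal_set S ->
  (forall x, (forall u, S u -> ip x u = 0) -> x = 0) -> infinite_set S.
Proof.
move=> [S1 S0] St /finite_seqP[s sS].
pose v (i : 'I_(size (undup s))) := nth 0 (undup s) i.
have Sv i : S (v i) by rewrite sS/= -mem_undup mem_nth.
have [x xv] := dimH v; apply: (xv (fun i => ip x (v i))).
apply/eqP; rewrite -subr_eq0; apply/eqP/St => u Su.
have us : u \in undup s by rewrite mem_undup; move: Su; rewrite sS.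
have iP : (index u (undup s) < size (undup s))%N by rewrite index_mem.
have uE : u = v (Ordinal iP) by rewrite /v/= nth_index.
rewrite ipBl ip_suml (bigD1 (Ordinal iP))//= big1 => [|j jP].
  by rewrite addr0 ipZl -uE -ip_norm S1// expr1n mulr1 subrr.
rewrite ipZl S0 ?mulr0// uE => /eqP; rewrite nth_uniq ?undup_uniq//.
by move=> /eqP ji; case/eqP: jP; exact/val_inj.
Qed.

Lemma total_orthonormal_set_basis S : orthonormal_set S ->
  (forall x, (forall u, S u -> ip x u = 0) -> x = 0) ->
  exists2 e, orthonormal_basis ip e & forall k, S (e k).
Proof.
move=> hS St; have [S1 S0] := hS.
have := eq_card_nat (orthonormal_set_countable hS)
  (total_orthonormal_set_infinite hS St).
rewrite card_eq_sym => /card_set_bijP[e [eS ei es]].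
have Se k : S (e k) by exact: eS.
exists e => //; split=> [i j|x xe].
  have [->|ij] := eqVneq i j; first by rewrite -ip_norm S1// expr1n.
  rewrite S0// => eij; case/eqP: ij.
  by apply: ei => //; rewrite inE.
by apply: St => u /es[k _ <-].
Qed.

(** Zorn gives a maximal orthonormal set of eigenvectors. It is total, since a nonzero vector
    orthogonal to it would produce a further eigenvector. *)
Lemma spectral_theorem A : hilbert_schmidt ip A -> self_adjoint ip A ->
  exists e (l : nat -> R), orthonormal_basis ip e /\
    forall k, A (e k) = l k *: e k.
Proof.
move=> [bA [b ob Ab]] sA.
have bC := fun n => series_le_lim n (fun k => sqr_ge0 `|A (b k)|) Ab.
pose P S := orthonormal_set S /\ forall u, S u -> exists l : R, A u = l *: u.
have [F FP Ftot|S [[hS SA] Smax]] := @Zorn_bigcup H P.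
  split; last by move=> u [X FX Xu]; have [_] := FP _ FX; exact.
  split; first by move=> u [X FX Xu]; have [[X1 _] _] := FP _ FX; exact: X1.
  move=> u v [X FX Xu] [Y FY Yv] uv.
  have [XY|YX] := Ftot _ _ FX FY.
    by have [[_ h] _] := FP _ FY; apply: h => //; exact: XY.
  by have [[_ h] _] := FP _ FX; apply: h => //; exact: YX.
have St x : (forall u, S u -> ip x u = 0) -> x = 0.
  move=> Sx; apply: contrapT => /eqP x0.
  have [v [l [v1 Sv Av]]] := hs_eigenvector ip_norm ob bA sA bC SA x0 Sx.
  have nSv : ~ S v.
    by move=> /Sv /eqP; rewrite -ip_norm v1 expr1n oner_eq0.
  apply: (Smax (S `|` [set v])).
    split; first by move=> u Su; left.
    by move=> /(_ v) h; apply/nSv/h; right.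
  have [S1 S0] := hS.
  split; last by move=> u [/SA//|->]; exists l.
  split=> [u [/S1//|->//]|u w [Su|->] [Sw|->] uw//].
  - exact: S0.
  - by rewrite ipC Sv.
  - by rewrite Sv.
have [e oe Se] := total_orthonormal_set_basis hS St.
have /choice[l lP] k : exists l : R, A (e k) = l *: e k by exact: SA.
by exists e, l.
Qed.

End SpectralTheorem.

(** * Logarithm, exponential and powers *)

(** Rules out bounded square sums whose terms stay away from 0. *)
Lemma natmul_bounded_le0 (R : realType) (a Q : R) :
  (forall n, n%:R * a <= Q) -> a <= 0.
Proof.
move=> aQ; rewrite leNgt; apply/negP => a0.
have Q0 : 0 <= Q by have := aQ 0; rewrite mul0r.
have := aQ (Num.bound (Q / a)); rewrite leNgt -ltr_pdivrMr//.
by apply/negP; rewrite negbK archi_boundP// divr_ge0// ltW.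
Qed.

Section FunctionalCalculus.
Context {R : realType} {H : completeNormedModType R} (ip : {dot H for idfun}).
Hypothesis ip_norm : hilbert_norm ip.
Implicit Types (x y : H) (A C D P S T : H -> H) (e : nat -> H) (c d l : nat -> R).

Lemma onb_norm e k : orthonormal_basis ip e -> `|e k| = 1.
Proof.
move=> oe; apply/eqP; rewrite -(@eqrXn2 _ 2)// ?expr1n ?ip_norm ?oe.1 ?eqxx//.
Qed.

Lemma eigenbasis_diag e c T : orthonormal_basis ip e -> bounded_op T ->
  (forall k, T (e k) = c k *: e k) -> bounded_seq c /\ T = diag ip e c.
Proof.
move=> oe bT Te; suff bc : bounded_seq c by split=> //; exact: diag_unique.
have [_ [K K0 TK]] := (bounded_opP T).1 bT.
by exists K => k; have := TK (e k); rewrite Te normrZ onb_norm// !mulr1.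
Qed.

(** In coordinates the hypothesis reads (c_k - c'_j) <S e_k, e'_j> = 0: wherever the matrix entry is
    nonzero, c_k = c'_j and hence f c_k = f c'_j. *)
Lemma diag_intertwine (f : R -> R) e e' c c' S :
  orthonormal_basis ip e -> orthonormal_basis ip e' ->
  bounded_seq c -> bounded_seq c' ->
  bounded_seq (f \o c) -> bounded_seq (f \o c') -> bounded_op S ->
  S \o diag ip e c = diag ip e' c' \o S ->
  S \o diag ip e (f \o c) = diag ip e' (f \o c') \o S.
Proof.
move=> oe oe' bc bc' bfc bfc' bS SE; have [lS _] := bS.
apply: (bounded_op_ext ip_norm oe).
- by apply: bounded_op_comp => //; exact: diag_bounded.
- by apply: bounded_op_comp => //; exact: diag_bounded.
move=> k; have := congr1 (fun g => g (e k)) SE; rewrite /= !diag_basis// !linZ//.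
move=> h; apply: (onb_eq oe') => j; rewrite ipZl ip_diag//=.
have := congr1 (ip^~ (e' j)) h; rewrite /= ipZl ip_diag// => /eqP.
rewrite -subr_eq0 -mulrBl mulf_eq0 subr_eq0 => /orP[/eqP->//|/eqP->].
by rewrite !mulr0.
Qed.

Lemma spectral_fun_diag (f : R -> R) e c : orthonormal_basis ip e ->
  bounded_seq c -> bounded_seq (f \o c) ->
  spectral_fun ip f (diag ip e c) = diag ip e (f \o c).
Proof.
move=> oe bc bfc; apply: xget_unique.
  split; first exact: diag_bounded.
  by exists e, c; split=> // k; rewrite diag_basis.
move=> T [bT [e' [c' [oe' ce Te]]]].
have [bc' cE] := eigenbasis_diag oe' (diag_bounded ip_norm oe bc) ce.
have [bfc' ->] := eigenbasis_diag oe' bT Te.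
(* Two eigenbases of the same operator are compared by intertwining along the identity. *)
have := @diag_intertwine f e' e c' c idfun oe' oe bc' bc bfc' bfc (bounded_op_id) .
by rewrite -cE; apply.
Qed.

Lemma inverse_of_id : inverse_of (idfun : H -> H) idfun.
Proof. by split=> //; exact: bounded_op_id. Qed.

Lemma op_inv_eq C D : inverse_of C D -> op_inv C = D.
Proof.
move=> CD; have [_ _ CDE DCE] := CD; apply: xget_unique => // D' [_ _ CD' D'C].
by rewrite -[D']/(D' \o idfun) -CDE compA D'C.
Qed.

(** Eigenvalues are stored through their logarithms: boundedness of [l] keeps them away from 0 and
    infinity, and powers become [expR (s * l k)]. *)
Definition PC2_eigen P e l (gamma : R) := [/\ orthonormal_basis ip e,
  bounded_seq l, P = diag ip e (expR \o l), 0 < gamma &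
  exists Q, forall n, \sum_(k < n) (expR (l k) - gamma) ^+ 2 <= Q].

Lemma bounded_seq_expR l : bounded_seq l -> bounded_seq (expR \o l).
Proof.
move=> [K lK]; exists (expR K) => k /=.
by rewrite ger0_norm ?expR_ge0// ler_expR (le_trans (ler_norm _)).
Qed.

Lemma PC2_eigenbasis A (gamma : R) :
  separable H -> infinite_dimensional H -> PC2_of ip A gamma ->
  exists e l, PC2_eigen (A + gamma *: idfun) e l gamma.
Proof.
move=> sepH dimH [hsA sA [bP sP [M M0 PM]]].
have [e [a [oe Ae]]] := spectral_theorem ip_norm sepH dimH hsA sA.
have [bA _] := hsA.
have [Q AQ] := hilbert_schmidt_bounded ip_norm sA hsA.
have Q2 n : \sum_(k < n) a k ^+ 2 <= Q.
  have := AQ _ (onb_bessel ip_norm oe) n; apply: le_trans.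
  apply: ler_sum => k _; rewrite Ae normrZ onb_norm// mulr1.
  by rewrite real_normK ?num_real.
have Pe k : (A + gamma *: idfun) (e k) = (a k + gamma) *: e k.
  by rewrite !fctE Ae scalerDl.
have aM k : M <= a k + gamma.
  by have := PM (e k); rewrite Pe ipZr oe.1 eqxx onb_norm// expr1n !mulr1.
have a0 k : 0 < a k + gamma by exact: lt_le_trans (aM k).
have [[K aK] PE] := eigenbasis_diag oe bP Pe.
exists e, (fun k => ln (a k + gamma)); split=> //.
- exists (`|ln M| + `|ln K|) => k.
  have lM : ln M <= ln (a k + gamma) by rewrite ler_ln ?posrE.
  have lK : ln (a k + gamma) <= ln K.
    rewrite ler_ln ?posrE//; first exact: (le_trans (ler_norm _)).
    by apply: (lt_le_trans (a0 k)); exact: (le_trans (ler_norm _)).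
  have := ler_norm (- ln M); have := ler_norm (ln K); rewrite normrN => h1 h2.
  by rewrite ler_norml; have := normr_ge0 (ln M); have := normr_ge0 (ln K); lra.
- rewrite PE; congr (diag ip e _); apply/funext => k /=.
  by rewrite lnK ?posrE.
(* If gamma <= 0, then a_k >= M for all k, against the summability of the squares of a_k. *)
- rewrite ltNge; apply/negP => g0.
  have MQ n : n%:R * M ^+ 2 <= Q.
    apply: le_trans (Q2 n); rewrite -[n in n%:R]card_ord -sumr_const mulr_suml.
    apply: ler_sum => k _; rewrite mul1r lerXn2r ?nnegrE ?(ltW M0)//.
      by have := aM k; lra.
    by have := aM k; lra.
  by have := natmul_bounded_le0 MQ; rewrite leNgt exprn_gt0.
- exists Q => n; under eq_bigr do rewrite lnK ?posrE// addrK.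
  exact: Q2.
Qed.

(** Given a second representation C' P' D' of the same operator, D' \o C intertwines P with P',
    hence also their logarithms. *)
Lemma op_log_diag C D e l : separable H -> infinite_dimensional H ->
  inverse_of C D -> orthonormal_basis ip e -> bounded_seq l ->
  PC2 ip (diag ip e (expR \o l)) ->
  op_log ip (C \o diag ip e (expR \o l) \o D) = C \o diag ip e l \o D.
Proof.
move=> sepH dimH CD oe bl Pl; have [bC bD CDE DCE] := CD.
have lnE m : @ln R \o (expR \o m) = m by apply/funext => k /=; rewrite expRK.
have logE e' m : orthonormal_basis ip e' -> bounded_seq m ->
    spectral_fun ip (@ln R) (diag ip e' (expR \o m)) = diag ip e' m.
  move=> oe' bm; rewrite spectral_fun_diag ?lnE//.
  exact: bounded_seq_expR.
apply: xget_unique; first by exists C, D, (diag ip e (expR \o l)); rewrite logE.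
move=> L [C' [D' [P' [CD' [A' [g [PA' ->]]] TE ->]]]].
have [bC' bD' CDE' DCE'] := CD'.
have [e' [l' [oe' bl' PE' _ _]]] := PC2_eigenbasis sepH dimH PA'.
move: TE; rewrite PE' logE// => TE.
have SE : (D' \o C) \o diag ip e (expR \o l) = diag ip e' (expR \o l') \o (D' \o C).
  apply/funext => x.
  have := congr1 (fun g => D' (g (C x))) TE => /=.
  have -> y : D (C y) = y by exact: (congr1 (fun h => h y) DCE).
  by have -> y : D' (C' y) = y by exact: (congr1 (fun h => h y) DCE').
have /= := @diag_intertwine (@ln R) e e' _ _ (D' \o C) oe oe'
  (bounded_seq_expR bl) (bounded_seq_expR bl') _ _ (bounded_op_comp bD' bC) SE.
rewrite !lnE => /(_ bl bl') SL; apply/funext => x /=.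
have := congr1 (fun g => C' (g (D x))) SL => /=.
have -> y : C (D y) = y by exact: (congr1 (fun h => h y) CDE).
by have -> y : C' (D' y) = y by exact: (congr1 (fun h => h y) CDE').
Qed.

(** Iterates telescope to C L^n D, so C leaves the sum by continuity. The remaining series is
    dominated by that of exp(K) |y| and is identified coordinate by coordinate. *)
Lemma op_exp_diag C D e l : inverse_of C D -> orthonormal_basis ip e ->
  bounded_seq l ->
  op_exp (C \o diag ip e l \o D) = C \o diag ip e (expR \o l) \o D.
Proof.
move=> [[lC cC] bD CDE DCE] oe bl; apply/funext => x /=.
set L := diag ip e l; set y := D x.
have lL : linear L by exact: diag_linear.
have itE n : iter n (C \o L \o D) x = C (iter n L y).
  have CD1 z : C (D z) = z by exact: (congr1 (fun h => h z) CDE).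
  have DC1 z : D (C z) = z by exact: (congr1 (fun h => h z) DCE).
  elim: n => [|n IHn]; first by rewrite /= /y CD1.
  by rewrite !iterS IHn /= DC1.
pose u n := (n`!%:R : R)^-1 *: iter n L y.
have ipu n k : ip (u n) (e k) = exp_coeff (l k) n * ip y (e k).
  rewrite ipZl /exp_coeff/=.
  have -> : ip (iter n L y) (e k) = l k ^+ n * ip y (e k).
    elim: n => [|n IHn]; first by rewrite mul1r.
    by rewrite iterS ip_diag// IHn exprS mulrA.
  by ring.
have cu : cvgn (series u).
  apply: normed_cvg; have [K lK] := bl.
  have K0 : 0 <= K by rewrite (le_trans _ (lK 0)).
  apply: (@series_le_cvg _ _ (fun n => exp_coeff K n * `|y|)).
  - by move=> n; exact: normr_ge0.
  - by move=> n; rewrite mulr_ge0 ?exp_coeff_ge0.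
  - move=> n /=; rewrite /u normrZ ger0_norm ?invr_ge0// /exp_coeff/= mulrAC mulrC.
    rewrite ler_wpM2r ?invr_ge0//.
    elim: n => [|n IHn]; first by rewrite mul1r.
    rewrite iterS (le_trans (diag_norm ip_norm _ oe lK))// exprS -mulrA.
    by rewrite ler_wpM2l.
  - rewrite (_ : (fun n => _) = `|y| *: exp_coeff K).
      by apply: is_cvg_seriesZ; exact: is_cvg_series_exp_coeff.
    by apply/funext => n; rewrite fctE mulrC.
have uE : series u @ \oo --> diag ip e (expR \o l) y.
  rewrite (_ : diag ip e _ _ = limn (series u))//.
  apply: (onb_eq oe) => k; rewrite ip_diag//; last exact: bounded_seq_expR.
  have h := cvg_ipl (x := e k) ip_norm cu.
  apply: (cvg_to_unique (@Rhausdorff R) _ _ h).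
  rewrite (_ : (fun n => _) = fun n => series (exp_coeff (l k)) n * ip y (e k)).
    by apply: cvgMl; exact: is_cvg_series_exp_coeff.
  apply/funext => n; rewrite /series/= ip_suml mulr_suml.
  by apply: eq_bigr => i _; rewrite ipu.
rewrite /op_exp; apply: cvg_lim; first exact: norm_hausdorff.
have h := cvg_comp _ _ uE (cC _).
rewrite (_ : series _ = C \o series u)//; apply/funext => n.
rewrite /series/= lin_sum//; apply: eq_bigr => k _.
by rewrite itE /u linZ.
Qed.

Lemma op_pow_diag C D e l (s : R) : separable H -> infinite_dimensional H ->
  inverse_of C D -> orthonormal_basis ip e -> bounded_seq l ->
  PC2 ip (diag ip e (expR \o l)) ->
  op_pow ip (C \o diag ip e (expR \o l) \o D) s =
    C \o diag ip e (fun k => expR (s * l k)) \o D.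
Proof.
move=> sepH dimH CD oe bl Pl; have [[lC _] _ _ _] := CD.
rewrite /op_pow op_log_diag//.
have bsl : bounded_seq (fun k => s * l k).
  by apply: (@bounded_seqM _ (fun=> s)) => //; exists `|s|.
rewrite (_ : s *: _ = C \o diag ip e (fun k => s * l k) \o D) ?op_exp_diag//.
apply/funext => x; rewrite -[LHS]/(s *: C (diag ip e l (D x))) /= -linZ//.
congr (C _).
by apply: (onb_eq oe) => k; rewrite ipZl !ip_diag// mulrA.
Qed.

End FunctionalCalculus.

(** * Trace class operators *)

Section TraceClass.
Context {R : realType} {H : completeNormedModType R} (ip : {dot H for idfun}).
Hypothesis ip_norm : hilbert_norm ip.
Hypothesis sepH : separable H.
Hypothesis dimH : infinite_dimensional H.
Implicit Types (x y : H) (A S T X Y : H -> H) (e : nat -> H).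

Lemma diag_ge0 e (c : nat -> R) x : orthonormal_basis ip e -> bounded_seq c ->
  (forall k, 0 <= c k) -> 0 <= ip x (diag ip e c x).
Proof.
move=> oe bc c0; have h := parseval ip_norm x (diag ip e c x) oe.
rewrite -oppr_le0; apply: (cvg_seq_le (cvgN h)) => n /=.
rewrite oppr_le0 sumr_ge0// => k _.
by rewrite ip_diag// mulrCA mulr_ge0// -expr2 sqr_ge0.
Qed.

(* In the polar decomposition X o Y = U |X o Y|, the eigenvalue s_k of |X o Y|
   at f_k equals <X' (U f_k), Y f_k>, which is summable over k. *)
Lemma trace_class_comp e X X' Y Y' : orthonormal_basis ip e ->
  bounded_op X -> bounded_op Y -> bounded_op X' -> bounded_op Y' ->
  adjoint_of ip X X' -> adjoint_of ip Y Y' ->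
  hs_bounded ip X -> hs_bounded ip Y -> trace_class ip (X \o Y).
Proof.
move=> oe bX bY bX' bY' XX' YY' hX hY.
pose T := X \o Y; pose T' := Y' \o X'.
have bT : bounded_op T by exact: bounded_op_comp.
have bT' : bounded_op T' by exact: bounded_op_comp.
have TT' : adjoint_of ip T T' by exact: adjoint_comp.
have hG : hs_bounded ip (T' \o T).
  by apply: hs_bounded_compl => //; exact: hs_bounded_compl.
have sG : self_adjoint ip (T' \o T).
  by move=> x y; rewrite /= ipC -TT' ipC TT'.
have [f [t [hf Gf]]] := spectral_theorem ip_norm sepH dimH
  (hs_bounded_hilbert_schmidt ip_norm oe (bounded_op_comp bT' bT) hG) sG.
have Tff i j : ip (T (f i)) (T (f j)) = t j * (i == j)%:R.
  by rewrite TT' -[T' (T _)]/((T' \o T) (f j)) Gf ipZr hf.1.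
pose s k := `|T (f k)|.
have sE k : s k ^+ 2 = t k by rewrite ip_norm Tff eqxx mulr1.
have [_ [K K0 TK]] := (bounded_opP T).1 bT.
have bs : bounded_seq s.
  exists K => k; rewrite normr_id; have := TK (f k).
  by rewrite (onb_norm ip_norm) ?mulr1.
have bS := diag_bounded ip_norm hf bs.
have sS := diag_self_adjoint ip_norm hf bs.
have SSE : diag ip f s \o diag ip f s = T' \o T.
  apply: (bounded_op_ext ip_norm hf); [exact: bounded_op_comp..|] => k.
  by rewrite Gf diag_comp// diag_basis -?expr2 ?sE//; exact: bounded_seqM.
split=> //; exists (diag ip f s); split.
  split=> //; last by exists T'.
  by move=> x; apply: diag_ge0 => // k; exact: normr_ge0.
exists f => //.
(* The vectors U f_k of the polar decomposition. As 0^-1 = 0, they vanish where s_k = 0: a Bessel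
   family rather than an orthonormal one. *)
pose u k := (s k)^-1 *: T (f k).
have bu : bessel ip u.
  apply: (orthogonal_bessel ip_norm) => [i j ij|i].
    by rewrite ipZl ipZr Tff (negbTE ij) !mulr0.
  rewrite ipZl ipZr Tff eqxx mulr1 -sE.
  have [->|s0] := eqVneq (s i) 0; first by rewrite invr0 mul0r.
  by rewrite le_eqVlt; apply/orP; left; apply/eqP; field.
have [C1 XC] := hs_bounded_adjoint ip_norm oe XX' hX.
have [C2 YC] := hY.
apply: (@bounded_series_cvg _ _ (2^-1 * (C1 + C2))) => [k|n].
  by rewrite diag_basis// ipZr hf.1 eqxx mulr1 normr_ge0.
have fb := onb_bessel ip_norm hf.
apply: (@le_trans _ _ (\sum_(k < n)
    2^-1 * (`|X' (u k)| ^+ 2 + `|Y (f k)| ^+ 2))); last first.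
  by rewrite -mulr_sumr ler_pM2l// big_split/= lerD// ?XC ?YC.
apply: ler_sum => k _; rewrite diag_basis// ipZr hf.1 eqxx mulr1.
have -> : s k = ip (X' (u k)) (Y (f k)).
  rewrite ipC -XX' -[X (Y _)]/(T (f k)) ipC /u ipZl Tff eqxx mulr1 -sE.
  have [->|s0] := eqVneq (s k) 0; first by rewrite invr0 mul0r.
  by field.
rewrite !ip_norm; have := ip_ge0 ip_norm (X' (u k) - Y (f k)).
by rewrite ipBl !ipBr (ipC _ (Y _) (X' _)); lra.
Qed.

(** With S = |A|, one has |A x| = |S x| and |S x|^2 <= K <x, S x> for K bounding S, so the square
    sum is at most K times the trace of S. *)
Lemma trace_class_hs A : trace_class ip A ->
  hs_bounded ip A /\ exists e, orthonormal_basis ip e.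
Proof.
move=> [bA [S [[bS sS pS [A' AA' SSE]] [e oe Se]]]].
split; last by exists e.
have [_ [K' K'0 SK']] := (bounded_opP S).1 bS.
pose K := K' + 1; have K0 : 0 < K by rewrite ltr_wpDl.
have SK x : `|S x| <= K * `|x|.
  by apply: (le_trans (SK' x)); rewrite ler_wpM2r// lerDl.
have AS x : `|A x| ^+ 2 = `|S x| ^+ 2.
  by rewrite !ip_norm AA' sS -[A' _]/((A' \o A) x) -SSE.
(* Positivity of S at [x - S x / K] *)
have SxK x : `|S x| ^+ 2 <= K * ip x (S x).
  have := pS (x - K^-1 *: S x).
  rewrite (linB bS.1) (linZ bS.1).
  rewrite ipBl !ipBr !ipZl !ipZr -(sS x (S x)) -ip_norm.
  have h : ip (S x) (S (S x)) <= K * `|S x| ^+ 2.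
    apply: (le_trans (ler_norm _)); apply: (le_trans (cauchy_schwarz ip_norm _ _)).
    by rewrite expr2 mulrCA ler_wpM2l.
  set a := `|S x| ^+ 2 in h *; set b := ip x (S x).
  set c := ip (S x) (S (S x)) in h *.
  have h2 : K^-1 * (K^-1 * c) <= K^-1 * a.
    by rewrite ler_pM2l ?invr_gt0// mulrC ler_pdivrMr// mulrC.
  move=> h3; rewrite -subr_ge0.
  have : 0 <= K * (b - K^-1 * a) by rewrite mulr_ge0 ?(ltW K0)//; lra.
  by rewrite mulrBr mulrA mulfV ?gt_eqF// mul1r.
have eC n : \sum_(k < n) `|A (e k)| ^+ 2 <=
    K * limn (series (fun k => ip (e k) (S (e k)))).
  apply: (@le_trans _ _ (\sum_(k < n) K * ip (e k) (S (e k)))).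
    by apply: ler_sum => k _; rewrite AS.
  by rewrite -mulr_sumr ler_pM2l//; exact: series_le_lim.
have hA' : hs_bounded ip A'.
  by eexists => u bu n; exact: (hs_adjoint_bound ip_norm oe AA' eC bu n).
exact: (hs_bounded_adjoint ip_norm oe (adjoint_sym AA') hA').
Qed.

(** A - B would be (h - g) I, which is Hilbert-Schmidt only for h = g, as it has the same norm on
    every basis vector. *)
Lemma trace_class_scalar_unique A B (g h : R) :
  trace_class ip A -> trace_class ip B ->
  A + g *: idfun = B + h *: idfun -> A = B /\ g = h.
Proof.
move=> /trace_class_hs[hA [e oe]] /trace_class_hs[hB _] E.
have AB : A + (-1) *: B = (h - g) *: (idfun : H -> H).
  have := congr1 (fun f : H -> H => f - g *: idfun - B) E.
  rewrite /= addrK scaleN1r => ->.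
  by rewrite scalerBl addrAC [B + _]addrC addrK.
have [C ABC] := hs_boundedD hA (hs_boundedZ (-1) hB).
have gh : g = h.
  apply/eqP; rewrite eq_sym -subr_eq0 -sqrf_eq0 eq_le sqr_ge0 andbT.
  apply: (@natmul_bounded_le0 _ _ C) => n.
  apply: le_trans (ABC _ (onb_bessel ip_norm oe) n).
  rewrite -[n in n%:R]card_ord -sumr_const mulr_suml.
  apply: ler_sum => k _; rewrite AB fctE/= normrZ (onb_norm ip_norm)// mulr1.
  by rewrite mul1r real_normK ?num_real.
by split=> //; move: E; rewrite gh => /addIr.
Qed.

Lemma detX_eq A (g : R) : trace_class ip A -> g != 0 ->
  detX ip (A + g *: idfun) = g * fredholm_det ip (g^-1 *: A).
Proof.
move=> tA g0; apply: xget_unique; first by exists A, g.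
move=> d [B [h [tB h0 E ->]]].
by have [-> ->] := trace_class_scalar_unique tA tB E.
Qed.

End TraceClass.

(** * Determinants of finite matrices *)

Section Determinants.
Context {R : realType}.
Implicit Types n m : nat.

(** Sylvester's identity, from two triangular factorisations of one block matrix. It trades the
    growing size n for the fixed size m. *)
Lemma det_1addmx n m (U : 'M[R]_(n, m)) (V : 'M[R]_(m, n)) :
  \det (1%:M + U *m V) = \det (1%:M + V *m U).
Proof.
have E1 : block_mx 1%:M (- V) U 1%:M =
    block_mx 1%:M 0 U 1%:M *m block_mx 1%:M (- V) 0 (1%:M + U *m V).
  by rewrite mulmx_block !mul1mx !mul0mx !mulmx1 !addr0 mulmxN addrCA addNr addr0.
have E2 : block_mx 1%:M (- V) U 1%:M =
    block_mx (1%:M + V *m U) (- V) 0 1%:M *m block_mx 1%:M 0 U 1%:M.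
  by rewrite mulmx_block !mul1mx !mul0mx !mulmx1 !mulmx0 !add0r mulNmx addrK.
have := congr1 determinant E1; rewrite {1}E2 !det_mulmx !det_lblock !det_ublock.
by rewrite !det1 !mulr1 !mul1r.
Qed.

(** det (X + u w) is the determinant of a bordered matrix in which w occurs only in the first row;
    multilinearity in that row gives the claim. *)
Lemma det_rank1_affine n (X : 'M[R]_n) (u : 'cV[R]_n) (v : 'rV[R]_n) (t : R) :
  \det (X + t *: (u *m v)) = (1 - t) * \det X + t * \det (X + u *m v).
Proof.
pose B (w : 'rV[R]_n) : 'M[R]_(1 + n) := block_mx 1%:M (- w) u X.
have detB w : \det (B w) = \det (X + u *m w).
  have -> : B w = block_mx 1%:M 0 u 1%:M *m block_mx 1%:M (- w) 0 (X + u *m w).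
    by rewrite mulmx_block !mul1mx !mul0mx !mulmx1 !addr0 mulmxN addrCA addNr
               addr0.
  by rewrite det_mulmx det_lblock det_ublock !det1 !mul1r.
rewrite scalemxAr -!detB -[X in (1 - t) * \det X]addr0 -(mulmx0 _ u) -detB.
have row'B w w' : row' (lshift n (0 : 'I_1)) (B w) = row' (lshift n 0) (B w').
  apply/matrixP => i j; rewrite !mxE; case: splitP => k /=.
    by rewrite ord1 /bump leq0n.
  by rewrite !mxE.
apply: (determinant_multilinear (i0 := lshift n 0)) => //.
apply/rowP => j; rewrite !mxE; case: splitP => // k _.
by rewrite !mxE; case: splitP => l _; rewrite !mxE; ring.
Qed.

Definition psdmx n (M : 'M[R]_n) :=
  M^T = M /\ forall v : 'rV[R]_n, 0 <= (v *m M *m v^T) 0 0.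

Lemma psdmx_diag_ge0 n (M : 'M[R]_n) i : psdmx M -> 0 <= M i i.
Proof.
move=> [_ /(_ (delta_mx 0 i))]; rewrite -rowE trmx_delta -colE !mxE.
by [].
Qed.

(** Induction on the Schur complement N - r^T r / a, which is again positive semidefinite and has
    smaller diagonal entries than N. If a = 0, positivity forces r = 0 and the determinant
    vanishes. *)
Lemma hadamard_psd n (M : 'M[R]_n) : psdmx M -> \det M <= \prod_i M i i.
Proof.
elim: n M => [|n IHn] M; first by rewrite det_mx00 big_ord0.
move: M; rewrite -[n.+1]/(1 + n)%N => M [symM psdM].
pose a := M 0 0; pose r : 'rV[R]_n := ursubmx M; pose N : 'M[R]_n := drsubmx M.
have ME : M = block_mx a%:M r r^T N.
  rewrite -[LHS]submxK; congr block_mx.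
    by apply/matrixP => i j; rewrite !mxE !ord1 eqxx mulr1n; congr (M _ _);
       apply/val_inj.
  by rewrite -[in LHS]symM trmx_ursub.
have a0 : 0 <= a by apply: psdmx_diag_ge0.
have quad (t : R) (w : 'rV[R]_n) :
    0 <= a * t ^+ 2 + 2 * t * (w *m r^T) 0 0 + (w *m N *m w^T) 0 0.
  have := psdM (row_mx t%:M w); rewrite {1}ME mul_row_block tr_row_mx mul_row_col.
  rewrite !mulmxDl !mul_scalar_mx tr_scalar_mx !mul_mx_scalar -scalemxAl.
  have -> : r *m w^T = (w *m r^T)^T by rewrite trmx_mul trmxK.
  set q := w *m r^T; set z := w *m N *m w^T => h.
  apply: (le_trans h); rewrite !mxE mulr1n le_eqVlt; apply/orP; left; apply/eqP.
  by ring.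
have symN : N^T = N by rewrite /N -{2}symM trmx_drsub.
have [a_eq0|a_neq0] := eqVneq a 0.
  have r0 : r = 0.
    have q0 (w : 'rV[R]_n) : (w *m r^T) 0 0 = 0.
      set q := (w *m r^T) 0 0; set z := (w *m N *m w^T) 0 0.
      apply/eqP/negPn/negP => qn0.
      (* With a = 0 the form is affine in t; this t gives it the value -1. *)
      have := quad (- (z + 1) / (2 * q)) w; rewrite a_eq0 mul0r add0r -/q -/z.
      have -> : 2 * (- (z + 1) / (2 * q)) * q = - (z + 1) by field.
      by rewrite opprD addrAC addNr add0r oppr_ge0 leNgt ltr01.
    have /psumr_eq0P h : \sum_j r 0 j ^+ 2 = 0.
      rewrite -[RHS](q0 r) [RHS]mxE; apply: eq_bigr => j _.
      by rewrite [r^T _ _]mxE expr2.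
    apply/rowP => i; rewrite [RHS]mxE; apply/eqP; rewrite -sqrf_eq0; apply/eqP.
    by apply: h => // j _; exact: sqr_ge0.
  have -> : \det M = 0.
    by rewrite ME r0 a_eq0 det_lblock det_scalar expr1 mul0r.
  by rewrite prodr_ge0// => i _; exact: psdmx_diag_ge0.
pose N' := N - a^-1 *: (r^T *m r).
have ME' : M = block_mx 1%:M 0 (a^-1 *: r^T) 1%:M *m block_mx a%:M r 0 N'.
  rewrite {1}ME mulmx_block !mul1mx !mul0mx !addr0 mul_mx_scalar.
  by rewrite scalerA mulfV// scale1r -scalemxAl addrC subrK.
have psdN' : psdmx N'.
  split.
    by rewrite /N' linearB linearZ/= trmx_mul trmxK symN.
  (* The minimiser in t of the quadratic form; its minimum is the form of N' at w. *)
  move=> w; have := quad (- a^-1 * (w *m r^T) 0 0) w.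
  rewrite /N' mulmxBr mulmxBl -scalemxAr -scalemxAl !mulmxA.
  have -> : w *m r^T *m r *m w^T = (w *m r^T) *m (w *m r^T)^T.
    by rewrite -mulmxA trmx_mul trmxK.
  set q := w *m r^T; set z := w *m N *m w^T => h.
  apply: (le_trans h); rewrite !mxE big_ord1 !mxE le_eqVlt; apply/orP; left.
  by apply/eqP; field.
rewrite {1}ME' det_mulmx det_lblock det_ublock !det1 !mul1r det_scalar expr1.
rewrite big_ord_recl.
have -> : M ord0 ord0 = a by congr (M _ _); apply/val_inj.
apply: ler_wpM2l => //; apply: (le_trans (IHn _ psdN')).
apply: ler_prod => i _; rewrite psdmx_diag_ge0//= /N' !mxE big_ord1 !mxE.
have -> : M (rshift 1 i) (rshift 1 i) = M (lift ord0 i) (lift ord0 i).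
  by congr (M _ _); apply/val_inj.
by rewrite gerBl mulr_ge0 ?invr_ge0// -expr2 sqr_ge0.
Qed.

Lemma hadamard n (W : 'M[R]_n) : \det W ^+ 2 <= \prod_i \sum_k W i k ^+ 2.
Proof.
rewrite expr2 -{2}det_tr -det_mulmx.
have h : psdmx (W *m W^T).
  split=> [|v]; first by rewrite trmx_mul trmxK.
  rewrite mulmxA -mulmxA -trmx_mul mxE sumr_ge0// => k _.
  by rewrite [(_^T) _ _]mxE -expr2 sqr_ge0.
apply: (le_trans (hadamard_psd h)); rewrite le_eqVlt; apply/orP; left; apply/eqP.
by apply: eq_bigr => i _; rewrite mxE; apply: eq_bigr => k _; rewrite mxE expr2.
Qed.

(** Row i of 1 + Z has squared norm 1 + 2 Z_ii + \sum_k Z_ik^2; then 1 + x <= exp x. The exponent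
    does not involve the size n. *)
Lemma det_1add_bound n (Z : 'M[R]_n) :
  \det (1%:M + Z) ^+ 2 <= expR (2 * \tr Z + \sum_i \sum_k Z i k ^+ 2).
Proof.
apply: (le_trans (hadamard _)).
rewrite /mxtrace mulr_sumr -big_split/= expR_sum.
apply: ler_prod => i _; rewrite sumr_ge0//= => [|k _]; last exact: sqr_ge0.
apply: le_trans (expR_ge1Dx _).
rewrite (bigD1 i)//= [X in _ <= 1 + (_ + X)](bigD1 i)//= !mxE eqxx.
rewrite le_eqVlt; apply/orP; left; apply/eqP.
rewrite (eq_bigr (fun k => Z i k ^+ 2)); first by rewrite /=; ring.
by move=> k ki; rewrite !mxE eq_sym (negbTE ki) add0r.
Qed.

End Determinants.

(** * Finite sections of a trace class operator *)

Lemma cvg_det (R : realType) n (A : nat -> 'M[R]_n) (B : 'M[R]_n) :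
  (forall i j, A m i j @[m --> \oo] --> B i j) ->
  \det (A m) @[m --> \oo] --> \det B.
Proof.
move=> AB; rewrite /determinant; apply: cvg_sum => s _.
apply: cvgZr; apply: (cvg_big (@mul_continuous R)) => i _; exact: AB.
Qed.

Section Sections.
Context {R : realType} {H : completeNormedModType R} (ip : {dot H for idfun}).
Hypothesis ip_norm : hilbert_norm ip.
Variables (e a b : nat -> H) (c : R).
Hypothesis oe : orthonormal_basis ip e.
Hypothesis ac : forall j, ip (a j) (a j) <= c.
Hypothesis bc : forall j, ip (b j) (b j) <= c.
Implicit Types (w : nat -> R) (m n : nat).

(** [lfactor w m n *m rfactor m n] is the n-th section, in the basis [e], of x |-> \sum_(j < m) w_j
    <b_j, x> a_j. *)
Definition lfactor w m n : 'M[R]_(n, m) :=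
  \matrix_(i, j) (w j * ip (e i) (a j)).

Definition rfactor m n : 'M[R]_(m, n) := \matrix_(j, k) ip (b j) (e k).

Let c_ge0 : 0 <= c.
Proof. exact: le_trans (ip_ge0 ip_norm _) (ac 0). Qed.

Lemma coord_sum_bound x y n : ip x x <= c -> ip y y <= c ->
  `|\sum_(i < n) ip x (e i) * ip y (e i)| <= c.
Proof.
move=> xc yc; have eb := onb_bessel ip_norm oe.
apply: (le_trans (ler_norm_sum _ _ _)).
apply: (@le_trans _ _ (\sum_(i < n)
    (2^-1 * ip x (e i) ^+ 2 + 2^-1 * ip y (e i) ^+ 2))).
  apply: ler_sum => i _; rewrite ler_norml.
  have := sqr_ge0 (ip x (e i) + ip y (e i)).
  by have := sqr_ge0 (ip x (e i) - ip y (e i)); nra.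
rewrite big_split/= -!mulr_sumr.
have := le_trans (eb x n) xc; have := le_trans (eb y n) yc; lra.
Qed.

(** Cyclicity of the trace reduces everything to m by m matrices whose entries Bessel's inequality
    bounds independently of n. The exponent is half of the one that bounds the square. *)
Lemma det_section_bound w s m n : \sum_(j < m) `|w j| <= s ->
  `|\det (1%:M + lfactor w m n *m rfactor m n)| <= expR (c * s + (c * s) ^+ 2 / 2).
Proof.
move=> ws; set U := lfactor w m n; set V := rfactor m n.
have s0 : 0 <= s by apply: le_trans ws; apply: sumr_ge0.
rewrite -ler_sqr ?nnegrE ?expR_ge0// real_normK ?num_real//.
apply: (le_trans (det_1add_bound _)); rewrite -expRM_natl ler_expR.
have VV j l : `|(V *m V^T) j l| <= c.
  rewrite mxE; under eq_bigr do rewrite !mxE.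
  exact: coord_sum_bound.
have UU j l : `|(U^T *m U) j l| <= `|w j| * `|w l| * c.
  rewrite mxE; under eq_bigr do rewrite !mxE mulrACA !(ipC _ (e _)).
  by rewrite -mulr_sumr normrM normrM ler_wpM2l ?mulr_ge0//; exact: coord_sum_bound.
have VU j : `|(V *m U) j j| <= `|w j| * c.
  rewrite mxE; under eq_bigr do rewrite !mxE mulrCA (ipC _ (e _)).
  by rewrite -mulr_sumr normrM ler_wpM2l//; exact: coord_sum_bound.
have t1 : \tr (U *m V) <= c * s.
  rewrite mxtrace_mulC; apply: (le_trans (ler_norm _)).
  apply: (le_trans (ler_norm_sum _ _ _)).
  apply: (@le_trans _ _ (\sum_(j < m) `|w j| * c)); first exact: ler_sum.
  by rewrite -mulr_suml mulrC ler_wpM2l.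
have t2 : \sum_i \sum_k (U *m V) i k ^+ 2 <= (c * s) ^+ 2.
  have -> : \sum_i \sum_k (U *m V) i k ^+ 2 = \tr ((U^T *m U) *m (V *m V^T)).
    rewrite -mulmxA mxtrace_mulC -mulmxA -(mulmxA V) -trmx_mul mulmxA.
    apply: eq_bigr => i _; rewrite [RHS]mxE; apply: eq_bigr => k _.
    by rewrite [(_^T) _ _]mxE expr2.
  apply: (le_trans (ler_norm _)); apply: (le_trans (ler_norm_sum _ _ _)).
  apply: (@le_trans _ _ (\sum_(j < m) \sum_(l < m) `|w j| * c * (`|w l| * c))).
    apply: ler_sum => j _; rewrite mxE; apply: (le_trans (ler_norm_sum _ _ _)).
    apply: ler_sum => l _; rewrite normrM.
    rewrite (_ : `|w j| * c * _ = `|w j| * `|w l| * c * c); last by ring.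
    exact: ler_pM.
  rewrite -big_distrlr/= expr2 -mulr_suml [_ * c]mulrC.
  by rewrite ler_pM ?mulr_ge0 ?sumr_ge0// ler_wpM2l.
by lra.
Qed.

Lemma factors_recr w m n : lfactor w m.+1 n *m rfactor m.+1 n =
  lfactor w m n *m rfactor m n +
    w m *: ((\col_i ip (e i) (a m)) *m (\row_k ip (b m) (e k))).
Proof.
apply/matrixP => i k; rewrite !mxE big_ord_recr/=; congr (_ + _).
  by apply: eq_bigr => j _; rewrite !mxE.
by rewrite big_ord1 !mxE mulrA.
Qed.

(* The determinant is affine in the coefficient w_m of the m-th rank one term,
   so it is enough to bound it for the coefficients 0 and 1. *)
Lemma det_section_step w s m n : \sum_(j < m) `|w j| <= s ->
  `|\det (1%:M + lfactor w m.+1 n *m rfactor m.+1 n) -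
    \det (1%:M + lfactor w m n *m rfactor m n)| <=
  2 * expR (c * (s + 1) + (c * (s + 1)) ^+ 2 / 2) * `|w m|.
Proof.
move=> ws; have s0 : 0 <= s by apply: le_trans ws; apply: sumr_ge0.
rewrite factors_recr addrA det_rank1_affine.
set X := 1%:M + _; set Y := X + _.
have -> : (1 - w m) * \det X + w m * \det Y - \det X = w m * (\det Y - \det X).
  by ring.
rewrite normrM mulrC ler_wpM2r//; apply: (le_trans (ler_normB _ _)).
rewrite mulr_natl mulr2n lerD//; last first.
  by apply: det_section_bound; rewrite (le_trans ws)// lerDl.
(* The coefficient 1 in position m is what raises the bound s to s + 1. *)
pose w' j := if (j < m)%N then w j else 1.
have -> : Y = 1%:M + lfactor w' m.+1 n *m rfactor m.+1 n.
  rewrite factors_recr /w' ltnn scale1r /Y /X addrA; congr (_ + _ *m _ + _).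
  by apply/matrixP => i j; rewrite !mxE ltn_ord.
apply: det_section_bound; rewrite big_ord_recr/= /w' ltnn normr1 lerD2r.
by rewrite (eq_bigr (fun j : 'I_m => `|w j|))// => j _; rewrite ltn_ord.
Qed.

Lemma det_section_tail w s m M n : (forall k, \sum_(j < k) `|w j| <= s) ->
  (m <= M)%N ->
  `|\det (1%:M + lfactor w M n *m rfactor M n) -
    \det (1%:M + lfactor w m n *m rfactor m n)| <=
  2 * expR (c * (s + 1) + (c * (s + 1)) ^+ 2 / 2) * \sum_(m <= j < M) `|w j|.
Proof.
move=> ws; elim: M => [|M IHM].
  by rewrite leqn0 => /eqP->; rewrite subrr normr0 big_geq// mulr0.
rewrite leq_eqVlt => /orP[/eqP->|]; first by rewrite subrr normr0 big_geq// mulr0.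
rewrite ltnS => mM; rewrite big_nat_recr//= mulrDr.
set D := fun m => \det (1%:M + lfactor w m n *m rfactor m n).
rewrite -[X in `|X|](subrKA (D M)) addrC.
apply: (le_trans (ler_normD _ _)); apply: lerD; first exact: IHM.
exact: det_section_step.
Qed.

(** After Sylvester's identity the size is m, so entrywise limits suffice; by Parseval they are
    delta_ij + w_j <b_i, a_j>, a diagonal matrix. *)
Lemma cvg_det_section w m : (forall i j, ip (b i) (a j) = (i == j)%:R) ->
  \det (1%:M + lfactor w m n *m rfactor m n) @[n --> \oo] -->
  \prod_(j < m) (1 + w j).
Proof.
move=> ba; under eq_fun do rewrite det_1addmx.
have -> : \prod_(j < m) (1 + w j) = \det (1%:M + diag_mx (\row_(j < m) w j)).
  have -> : 1%:M + diag_mx (\row_(j < m) w j) = diag_mx (\row_(j < m) (1 + w j)).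
    by apply/matrixP => i j; rewrite !mxE; case: eqVneq; rewrite ?addr0.
  by rewrite det_diag; apply: eq_bigr => j _; rewrite mxE.
apply: cvg_det => i j; rewrite !mxE.
under eq_fun do rewrite !mxE.
apply: cvgD; first exact: cvg_cst.
rewrite (_ : w i *+ _ = w j * ip (b i) (a j)); last first.
  by rewrite ba val_eqE; case: eqVneq => [->|_]; rewrite ?mulr1 ?mulr0.
rewrite (_ : (fun n => _) = fun n =>
    w j * series (fun k => ip (b i) (e k) * ip (a j) (e k)) n).
  by apply: cvgMr; exact: parseval.
apply/funext => n; rewrite /series/= big_mkord mulr_sumr.
by apply: eq_bigr => k _; rewrite !mxE (ipC _ (e k)) mulrCA.
Qed.

(** The truncation error is uniform in n, so m can be fixed first and n sent to infinity afterwards;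
    each of the two steps costs eps / 2. *)
Lemma det_section_approx w s (Z : forall n, 'M[R]_n) eps :
  (forall i j, ip (b i) (a j) = (i == j)%:R) ->
  (forall k, \sum_(j < k) `|w j| <= s) ->
  (forall n (i k : 'I_n),
    series (fun j => w j * ip (e i) (a j) * ip (b j) (e k)) @ \oo --> Z n i k) ->
  0 < eps ->
  \forall m \near \oo, \forall n \near \oo,
    `|\det (1%:M + Z n) - \prod_(j < m) (1 + w j)| <= eps.
Proof.
move=> ba ws wZ eps0.
pose D m n := \det (1%:M + lfactor w m n *m rfactor m n).
pose Q := 2 * expR (c * (s + 1) + (c * (s + 1)) ^+ 2 / 2).
have Q0 : 0 < Q by rewrite mulr_gt0// expR_gt0.
have DZ n : D m n @[m --> \oo] --> \det (1%:M + Z n).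
  apply: cvg_det => i k; rewrite !mxE; under eq_fun do rewrite !mxE.
  apply: cvgD; first exact: cvg_cst.
  rewrite (_ : (fun m => _) =
    series (fun j => w j * ip (e i) (a j) * ip (b j) (e k))); first exact: wZ.
  apply/funext => m; rewrite /series/= big_mkord.
  by apply: eq_bigr => j _; rewrite !mxE.
have cw : cvgn (series (fun j => `|w j|)) by exact: (bounded_series_cvg _ ws).
have /cauchy_cvgP/cauchy_seriesP := cw.
have e2Q : 0 < eps / 2 / Q by rewrite !divr_gt0.
move=> /(_ _ e2Q)[[P1 P2] /= [[N1 _ NP1] [N2 _ NP2]] PP].
exists (maxn N1 N2) => // m /=; rewrite geq_max => /andP[N1m N2m].
have tail n : `|\det (1%:M + Z n) - D m n| <= eps / 2.
  have : `|D M n - D m n| @[M --> \oo] --> `|\det (1%:M + Z n) - D m n|.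
    by apply: cvg_norm; apply: cvgB; [exact: DZ|exact: cvg_cst].
  move=> h; rewrite -(cvg_lim (@Rhausdorff R) h); apply: limr_le.
    by apply/cvg_ex; eexists; exact: h.
  near=> M; have mM : (m <= M)%N by near: M; exists m.
  apply: (le_trans (det_section_tail _ ws mM)).
  rewrite -/Q mulrC -ler_pdivlMr//.
  have /= := PP (m, M); rewrite ger0_norm ?sumr_ge0// => hM; apply/ltW/hM; split.
    exact: NP1.
  by apply: NP2 => /=; exact: leq_trans mM.
have /cvgrPdist_le/(_ (eps / 2)) : D m n @[n --> \oo] --> \prod_(j < m) (1 + w j).
  exact: cvg_det_section.
move=> /(_ ltac:(by rewrite divr_gt0)); apply: filterS => n Dn.
rewrite -[X in `|X|](subrKA (D m n)) (splitr eps).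
apply: (le_trans (ler_normD _ _)); apply: lerD; first exact: tail.
by rewrite distrC.
Unshelve. all: by end_near. Qed.

End Sections.

(** * Conjugated diagonal operators *)

(** For a single well chosen m, the number [z m] is a bridge between [x n] and [y n] for all large
    n. *)
Lemma cvg_common_approx (R : realType) (x y z : nat -> R) (d : R) :
  (forall eps, 0 < eps ->
    \forall m \near \oo, \forall n \near \oo, `|x n - z m| <= eps) ->
  (forall eps, 0 < eps ->
    \forall m \near \oo, \forall n \near \oo, `|y n - z m| <= eps) ->
  x @ \oo --> d -> y @ \oo --> d.
Proof.
move=> xz yz /cvgrPdist_le xd; apply/cvgrPdist_le => eps eps0.
have eps3 : 0 < eps / 3 by rewrite divr_gt0.
have [m [xm ym]] := filter_ex (filterI (xz _ eps3) (yz _ eps3)).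
have := xd _ eps3; move: xm ym; apply: filterS3 => n.
rewrite !ler_norml => /andP[? ?] /andP[? ?] /andP[? ?].
by apply/andP; split; lra.
Qed.

Section Conjugation.
Context {R : realType} {H : completeNormedModType R} (ip : {dot H for idfun}).
Hypothesis ip_norm : hilbert_norm ip.
Hypothesis sepH : separable H.
Hypothesis dimH : infinite_dimensional H.
Implicit Types (C D : H -> H) (e f : nat -> H) (w : nat -> R) (s : R).

Lemma summable_bounded w s : (forall n, \sum_(k < n) `|w k| <= s) -> bounded_seq w.
Proof.
move=> ws; exists s => k; apply: le_trans (ws k.+1).
by rewrite big_ord_recr/= lerDr sumr_ge0.
Qed.

(** Split w_k into sqrt |w_k| and sgn(w_k) sqrt |w_k|: both are square summable, so each side of the
    product C u, v D is Hilbert-Schmidt. *)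
Lemma trace_class_conj C D e w s : orthonormal_basis ip e ->
  bounded_op C -> bounded_op D -> self_adjoint ip C -> self_adjoint ip D ->
  (forall n, \sum_(k < n) `|w k| <= s) ->
  trace_class ip (C \o diag ip e w \o D).
Proof.
move=> oe bC bD sC sD ws; have bw := summable_bounded ws.
pose u k := Num.sqrt `|w k|; pose v k := Num.sg (w k) * u k.
have u2 k : u k ^+ 2 = `|w k| by rewrite sqr_sqrtr.
have v2 k : v k ^+ 2 <= `|w k|.
  rewrite exprMn u2 ler_piMl// sqr_sg; by case: (_ != 0).
have bu : bounded_seq u.
  have [K wK] := bw; exists (Num.sqrt K) => k.
  by rewrite ger0_norm ?sqrtr_ge0// ler_wsqrtr.
have bv : bounded_seq v.
  apply: (@bounded_seqM _ (fun k => Num.sg (w k))) => //.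
  by exists 1 => k; rewrite normr_sg; case: (_ != 0).
have bdu := diag_bounded ip_norm oe bu; have bdv := diag_bounded ip_norm oe bv.
have sdu := diag_self_adjoint ip_norm oe bu.
have sdv := diag_self_adjoint ip_norm oe bv.
have hu : hs_bounded ip (diag ip e u).
  apply: (hs_bounded_diag ip_norm oe bu) => n.
  by under eq_bigr do rewrite u2; exact: ws.
have hv : hs_bounded ip (diag ip e v).
  apply: (hs_bounded_diag ip_norm oe bv) => n.
  by apply: le_trans (ws n); apply: ler_sum => k _; exact: v2.
have -> : C \o diag ip e w \o D = (C \o diag ip e u) \o (diag ip e v \o D).
  rewrite (_ : diag ip e w = diag ip e u \o diag ip e v)// diag_comp//.
  congr (diag ip e _); apply/funext => k.
  by rewrite /v mulrCA -expr2 u2 -numEsg.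
apply: (trace_class_comp ip_norm sepH dimH oe (bounded_op_comp bC bdu)
  (bounded_op_comp bdv bD) (bounded_op_comp bdu bC) (bounded_op_comp bD bdv)).
- exact: adjoint_comp.
- exact: adjoint_comp.
- exact: hs_bounded_compl.
- exact: (hs_bounded_compr ip_norm oe sdv sD bD hv).
Qed.

(** As D is self-adjoint, C K D x = \sum_j w_j <D e_j, x> C e_j, and <D e_i, C e_j> = <e_i, D C e_j>
    = delta_ij gives biorthogonality. *)
Lemma fredholm_det_section_approx C D e f w s eps :
  orthonormal_basis ip e -> orthonormal_basis ip f -> inverse_of C D ->
  self_adjoint ip D -> (forall n, \sum_(k < n) `|w k| <= s) -> 0 < eps ->
  \forall m \near \oo, \forall n \near \oo,
    `|\det (\matrix_(i < n, j < n)
       ((i == j)%:R + ip (f i) ((C \o diag ip e w \o D) (f j)))) -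
      \prod_(j < m) (1 + w j)| <= eps.
Proof.
move=> oe of_ [bC bD CDE DCE] sD ws eps0; have bw := summable_bounded ws.
have [_ [K K0 CK]] := (bounded_opP C).1 bC.
have [_ [L L0 DL]] := (bounded_opP D).1 bD.
pose a j := C (e j); pose b j := D (e j).
pose c := K ^+ 2 + L ^+ 2.
have ac j : ip (a j) (a j) <= c.
  rewrite -ip_norm (@le_trans _ _ (K ^+ 2))// ?lerDl ?sqr_ge0//.
  by rewrite lerXn2r ?nnegrE// (le_trans (CK _))// (onb_norm ip_norm)// mulr1.
have bc j : ip (b j) (b j) <= c.
  rewrite -ip_norm (@le_trans _ _ (L ^+ 2))// ?lerDr ?sqr_ge0//.
  by rewrite lerXn2r ?nnegrE// (le_trans (DL _))// (onb_norm ip_norm)// mulr1.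
have ba i j : ip (b i) (a j) = (i == j)%:R.
  by rewrite sD -[D _]/((D \o C) (e j)) DCE oe.1.
pose Z n := \matrix_(i < n, j < n) ip (f i) ((C \o diag ip e w \o D) (f j)).
have ZE n (i k : 'I_n) :
    series (fun j => w j * ip (f i) (a j) * ip (b j) (f k)) @ \oo --> Z n i k.
  rewrite mxE /=; have [lC cC] := bC.
  have h := cvg_comp _ _ (diag_cvg ip_norm (D (f k)) oe bw) (cC _).
  have := cvg_ipr (x := f i) ip_norm h.
  rewrite (_ : series _ = fun n => ip (f i) (C (series
    (fun j => (w j * ip (D (f k)) (e j)) *: e j) n)))//.
  apply/funext => N; rewrite /series/= lin_sum// ip_sumr.
  by apply: eq_bigr => j _; rewrite linZ// ipZr sD ipC -/(b j); ring.
have := det_section_approx ip_norm of_ ac bc ba ws ZE eps0.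
apply: filterS => m; apply: filterS => n; congr (`|\det _ - _| <= _).
by apply/matrixP => i j; rewrite !mxE.
Qed.

(** The sections of both operators are approximated by the same products, the unconjugated case
    being C = D = I. Hence they have the same limits in every basis. *)
Lemma fredholm_det_conj C D e w s : orthonormal_basis ip e ->
  inverse_of C D -> self_adjoint ip D ->
  (forall n, \sum_(k < n) `|w k| <= s) ->
  fredholm_det ip (C \o diag ip e w \o D) = fredholm_det ip (diag ip e w).
Proof.
move=> oe CD sD ws; congr (xget 0 _).
have sid : self_adjoint ip (idfun : H -> H) by [].
apply/seteqP; split=> d dP f hf; move: (dP f hf); apply: cvg_common_approx.
- by move=> eps; exact: (fredholm_det_section_approx oe hf CD sD ws).
- by move=> eps; exact: (fredholm_det_section_approx oe hf inverse_of_id sid ws).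
- by move=> eps; exact: (fredholm_det_section_approx oe hf inverse_of_id sid ws).
- by move=> eps; exact: (fredholm_det_section_approx oe hf CD sD ws).
Qed.

End Conjugation.

(** * Second-order estimate for the power mean *)

Section PowerMean.
Context {R : realType}.
Implicit Types (l : nat -> R) (x y t : R).

(** From exp x >= 1 + x at t and -t, the remainder is between 0 and t (exp t - 1). This is at most
    t^2 exp t for t >= 0 and t^2 for t < 0. *)
Lemma expR_taylor1 t : `|expR t - 1 - t| <= t ^+ 2 * (1 + expR t).
Proof.
have h1 := expR_ge1Dx t; have h2 := expR_ge1Dx (- t).
have et := expR_gt0 t; have h3 := expRxMexpNx_1 t.
rewrite ger0_norm; last by rewrite -addrA -opprD subr_ge0.
have h4 : expR t - 1 <= t * expR t.
  have : expR t * (1 - t) <= 1 by rewrite -[leRHS]h3 ler_pM2l.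
  by rewrite mulrBr mulr1; lra.
have [t0|t0] := leP 0 t; first by nra.
have : expR t < 1 by rewrite expR_lt1.
by nra.
Qed.

(** The logarithm is Lipschitz with constant exp L on [exp (-L), exp L]; this turns square
    summability of eigenvalue differences into that of their logarithms. *)
Lemma expR_dist x y (L : R) : `|x| <= L -> `|y| <= L ->
  (x - y) ^+ 2 <= expR L ^+ 2 * (expR x - expR y) ^+ 2.
Proof.
wlog yx : x y / y <= x.
  move=> h xL yL; have [/h|/ltW/h] := leP y x; first exact.
  by rewrite -sqrrN opprB -[(expR x - _) ^+ 2]sqrrN opprB; apply.
rewrite [`|y| <= L]ler_norml => _ /andP[yL _].
rewrite -exprMn lerXn2r ?nnegrE ?subr_ge0//.
  by rewrite mulr_ge0 ?expR_ge0// subr_ge0 ler_expR.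
have Ly : 1 <= expR (L + y) by rewrite -expR0 ler_expR; lra.
rewrite mulrBr -!expRD (_ : L + x = (L + y) + (x - y)); last by ring.
rewrite expRD; have := expR_ge1Dx (x - y).
have : 0 <= x - y by rewrite subr_ge0.
set E := expR (x - y); set F := expR (L + y) in Ly *.
by nra.
Qed.

(* The balance condition kills the first-order term at l_k = ln nu. *)
Lemma power_mean_summable l (nu alpha beta p q Q : R) : bounded_seq l ->
  0 < nu -> 0 < alpha -> 0 < beta ->
  (forall n, \sum_(k < n) (expR (l k) - nu) ^+ 2 <= Q) ->
  p * alpha * nu `^ p = q * beta * nu `^ (- q) ->
  exists s, forall n, \sum_(k < n)
    `|alpha * expR (p * l k) + beta * expR (- q * l k) -
      (alpha * nu `^ p + beta * nu `^ (- q))| <= s.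
Proof.
move=> [K lK] nu0 a0 b0 lQ pq.
have [m nuE] := expR_total nu0.
have powE r : nu `^ r = expR (r * m) by rewrite -nuE -expRM mulrC.
pose L := K + `|m|.
have lL k : `|l k| <= L by rewrite (le_trans (lK k))// lerDl.
have mL : `|m| <= L by rewrite lerDr (le_trans _ (lK 0)).
pose a := alpha * nu `^ p; pose b := beta * nu `^ (- q).
have a0' : 0 <= a by rewrite mulr_ge0 ?powR_ge0// ltW.
have b0' : 0 <= b by rewrite mulr_ge0 ?powR_ge0// ltW.
have M0 r d : 0 <= d -> 0 <= d * (r ^+ 2 * (1 + expR (`|r| * (L + L)))).
  move=> d0; apply: mulr_ge0 => //; apply: mulr_ge0; first exact: sqr_ge0.
  by rewrite addr_ge0 ?expR_ge0.
(* Taylor constants at p and -q for |v| <= 2 L, times the squared Lipschitz constant of the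
   logarithm. *)
pose M := (a * (p ^+ 2 * (1 + expR (`|p| * (L + L)))) +
           b * (q ^+ 2 * (1 + expR (`|q| * (L + L))))) * expR L ^+ 2.
exists (M * Q) => n.
apply: (@le_trans _ _ (\sum_(k < n) M * (expR (l k) - nu) ^+ 2)); last first.
  by rewrite -mulr_sumr ler_wpM2l// mulr_ge0 ?sqr_ge0// addr_ge0// M0.
apply: ler_sum => k _; set v := l k - m.
have E r : expR (r * l k) = nu `^ r * expR (r * v).
  by rewrite powE -expRD /v; congr expR; ring.
(* The inserted linear terms - a p v and b q v cancel, the balance condition being p a = q b. *)
have -> : alpha * expR (p * l k) + beta * expR (- q * l k) -
      (alpha * nu `^ p + beta * nu `^ (- q)) =
    a * (expR (p * v) - 1 - p * v) + b * (expR (- q * v) - 1 - (- q * v)).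
  have h : p * a = q * b by rewrite /a /b !mulrA.
  rewrite !E; transitivity (a * (expR (p * v) - 1) + b * (expR (- q * v) - 1)).
    by rewrite /a /b; ring.
  have : v * (p * a) = v * (q * b) by rewrite h.
  set x := expR _; set y := expR _ => hv.
  apply/eqP; rewrite -subr_eq0; apply/eqP.
  rewrite (_ : _ - _ = v * (p * a) - v * (q * b)); last by ring.
  by rewrite hv subrr.
have vL : `|v| <= L + L by rewrite (le_trans (ler_normB _ _))// lerD.
have T r : `|expR (r * v) - 1 - r * v| <=
    r ^+ 2 * (1 + expR (`|r| * (L + L))) * v ^+ 2.
  apply: (le_trans (expR_taylor1 _)); rewrite exprMn mulrAC ler_wpM2r ?sqr_ge0//.
  rewrite ler_wpM2l ?sqr_ge0// lerD2l ler_expR (le_trans (ler_norm _))//.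
  by rewrite normrM ler_wpM2l.
apply: (le_trans (ler_normD _ _)).
rewrite (normrM a) (normrM b) (ger0_norm a0') (ger0_norm b0').
have vE := expR_dist (lL k) mL; rewrite nuE -/v in vE.
apply: (@le_trans _ _ ((a * (p ^+ 2 * (1 + expR (`|p| * (L + L)))) +
           b * (q ^+ 2 * (1 + expR (`|q| * (L + L))))) * v ^+ 2)).
  rewrite mulrDl lerD// -mulrA ler_wpM2l//.
  by have := T (- q); rewrite sqrrN normrN.
by rewrite /M -mulrA ler_wpM2l// addr_ge0// M0.
Qed.

End PowerMean.

(** * Congruence by the inverse square root *)

Section Whitening.
Context {R : realType} {H : completeNormedModType R} (ip : {dot H for idfun}).
Hypothesis ip_norm : hilbert_norm ip.
Hypothesis sepH : separable H.
Hypothesis dimH : infinite_dimensional H.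
Implicit Types (A C D T : H -> H) (e f : nat -> H) (l : nat -> R).

Lemma bounded_seq_expRZ l (s : R) : bounded_seq l ->
  bounded_seq (fun k => expR (s * l k)).
Proof.
move=> bl; apply: (@bounded_seq_expR _ (fun k => s * l k)).
by apply: (@bounded_seqM _ (fun=> s)) => //; exists `|s|.
Qed.

Lemma diag_expR_comp e l (s t : R) : orthonormal_basis ip e -> bounded_seq l ->
  diag ip e (fun k => expR (s * l k)) \o diag ip e (fun k => expR (t * l k)) =
  diag ip e (fun k => expR ((s + t) * l k)).
Proof.
move=> oe bl; rewrite diag_comp//; try exact: bounded_seq_expRZ.
by congr (diag ip e _); apply/funext => k; rewrite -expRD mulrDl.
Qed.

Lemma diag_expR_inverse e l (s : R) : orthonormal_basis ip e -> bounded_seq l ->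
  inverse_of (diag ip e (fun k => expR (s * l k)))
             (diag ip e (fun k => expR (- s * l k))).
Proof.
move=> oe bl; have h t : t = 0 -> diag ip e (fun k => expR (t * l k)) = idfun.
  move=> ->; rewrite -(diag1 ip_norm oe); congr (diag ip e _).
  by apply/funext => k; rewrite mul0r expR0.
split; try by apply: diag_bounded => //; exact: bounded_seq_expRZ.
  by rewrite diag_expR_comp// h// subrr.
by rewrite diag_expR_comp// h// addNr.
Qed.

(** Lam = W A W + gamma (W^2 - I / mu), where both terms are Hilbert-Schmidt. *)
Lemma PC2_of_congruence A Lam f l (gamma mu : R) :
  PC2_of ip A gamma -> orthonormal_basis ip f -> bounded_seq l -> 0 < mu ->
  (exists Q, forall n, \sum_(k < n) (expR (l k) - mu) ^+ 2 <= Q) ->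
  let W := diag ip f (fun k => expR (- 2^-1 * l k)) in
  Lam + (gamma / mu) *: idfun = W \o (A + gamma *: idfun) \o W ->
  PC2_of ip Lam (gamma / mu).
Proof.
move=> [hA sA [bP sP [M M0 PM]]] hf bl mu0 [Q lQ] W LamE.
have bw s := bounded_seq_expRZ s bl.
have bW : bounded_op W by exact: diag_bounded.
have sW : self_adjoint ip W by exact: diag_self_adjoint.
have [bA _] := hA.
(* Diagonal of W^2 - I / mu. It equals - (exp l_k - mu) exp (- l_k) / mu, which inherits square
   summability. *)
pose d k := expR (- l k) - mu^-1.
have bd : bounded_seq d.
  have [K hK] := bw (-1); exists (K + `|mu^-1|) => k.
  rewrite (le_trans (ler_normB _ _))// lerD//.
  by have := hK k; rewrite mulN1r.
have LE : Lam = (W \o A \o W) + gamma *: diag ip f d.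
  apply/funext => x.
  have -> : Lam x = W (A (W x) + gamma *: W x) - (gamma / mu) *: x.
    apply/eqP; rewrite eq_sym subr_eq eq_sym; apply/eqP.
    exact: (congr1 (fun g => g x) LamE).
  rewrite (linD bW.1) (linZ bW.1) -addrA.
  rewrite -[RHS]/(W (A (W x)) + gamma *: diag ip f d x).
  congr (_ + _).
  apply: (onb_eq hf) => k; rewrite ipBl !ipZl !ip_diag//.
  have wE : expR (- 2^-1 * l k) * expR (- 2^-1 * l k) = expR (- l k).
    by rewrite -expRD; congr expR; lra.
  by rewrite /d -wE; ring.
have bD := diag_bounded ip_norm hf bd.
have sD := diag_self_adjoint ip_norm hf bd.
have bL : bounded_op Lam.
  rewrite LE; apply: bounded_opD; last exact: bounded_opZ.
  by apply: bounded_op_comp => //; exact: bounded_op_comp.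
have sL : self_adjoint ip Lam.
  by move=> x y; rewrite LE !fctE/= ipDl ipDr ipZl ipZr sW sA sW sD.
have hD : hs_bounded ip (diag ip f d).
  have [K hK] := bw (-1); pose G := (K / mu) ^+ 2.
  apply: (hs_bounded_diag (C := G * Q) ip_norm hf bd) => n.
  apply: (@le_trans _ _ (\sum_(k < n) G * (expR (l k) - mu) ^+ 2)).
    apply: ler_sum => k _.
    have -> : d k = - (expR (- l k) / mu * (expR (l k) - mu)).
      rewrite /d expRN; field.
      by rewrite gt_eqF// gt_eqF// expR_gt0.
    rewrite sqrrN exprMn ler_wpM2r ?sqr_ge0// /G lerXn2r ?nnegrE//.
    - by rewrite divr_ge0 ?expR_ge0// ltW.
    - rewrite divr_ge0// ?(ltW mu0)//; exact: le_trans (hK 0).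
    - rewrite ler_wpM2r ?invr_ge0 ?(ltW mu0)//.
      by apply: le_trans (hK k); rewrite mulN1r ler_norm.
  rewrite -mulr_sumr ler_wpM2l// /G; exact: sqr_ge0.
split=> //.
  apply: (hs_bounded_hilbert_schmidt ip_norm hf bL); rewrite LE.
  apply: hs_boundedD; last exact: hs_boundedZ.
  apply: (hs_bounded_compr ip_norm hf _ sW bW).
    exact: (adjoint_comp sW sA).
  apply: hs_bounded_compl => //.
  exact: (hilbert_schmidt_bounded ip_norm sA hA).
(* The bounded inverse C of W gives |x| <= K1 |W x|, hence the lower bound M / K1^2. *)
have [bC _ CW _] := diag_expR_inverse (2^-1) hf bl.
set C := diag ip f (fun k => expR (2^-1 * l k)) in bC CW.
have [_ [K K0 CK]] := (bounded_opP C).1 bC.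
pose K1 := K + 1; have K10 : 0 < K1 by rewrite ltr_wpDl.
rewrite LamE; split.
- by apply: bounded_op_comp => //; exact: bounded_op_comp.
- by move=> x y; rewrite /= sW sP sW.
exists (M / K1 ^+ 2) => [|x]; first by rewrite divr_gt0// exprn_gt0.
rewrite /= -sW; apply: le_trans (PM (W x)).
rewrite -mulrA ler_pM2l// mulrC ler_pdivrMr ?exprn_gt0// -exprMn.
rewrite lerXn2r ?nnegrE ?mulr_ge0 ?(ltW K10)//.
have xE : C (W x) = x by exact: (congr1 (fun g => g x) CW).
have := CK (W x); rewrite xE => h; apply: (le_trans h).
by rewrite mulrC ler_wpM2l// lerDl.
Qed.

End Whitening.

Theorem proposition3 (R : realType) (H : completeNormedModType R)
    (ip : {dot H for idfun}) (ip_norm : hilbert_norm ip)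
    (sepH : separable H) (dimH : infinite_dimensional H)
    (A B : H -> H) (gamma mu : R)
    (PA : PC2_of ip A gamma) (PB : PC2_of ip B mu)
    (Lam : H -> H)
    (LamE : Lam + (gamma / mu) *: idfun =
       op_pow ip (B + mu *: idfun) (- 2^-1) \o (A + gamma *: idfun)
         \o op_pow ip (B + mu *: idfun) (- 2^-1))
    (alpha beta : R) (alpha_gt0 : 0 < alpha) (beta_gt0 : 0 < beta)
    (p q : R)
    (pqE : p * alpha * (gamma / mu) `^ p = q * beta * (gamma / mu) `^ (- q)) :
  let AB := (A + gamma *: idfun) \o op_inv (B + mu *: idfun) in
  let mean (T : H -> H) : H -> H :=
    (alpha + beta)^-1 *:
      (alpha *: op_pow ip T p + beta *: op_pow ip T (- q)) in
  TrX ip (mean AB) /\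
  detX ip (mean AB) = detX ip (mean (Lam + (gamma / mu) *: idfun)).
Proof.
move=> AB mean.
have [f [b [hf bb BE mu0 bmu]]] := PC2_eigenbasis ip_norm sepH dimH PB.
have [e0 [l0 [_ _ _ gamma0 _]]] := PC2_eigenbasis ip_norm sepH dimH PA.
set C := diag ip f (fun k => expR (2^-1 * b k)).
set W := diag ip f (fun k => expR (- 2^-1 * b k)).
have CW : inverse_of C W by exact: diag_expR_inverse.
have [bC bW CWE WCE] := CW.
have sC : self_adjoint ip C.
  by apply: diag_self_adjoint => //; exact: bounded_seq_expRZ.
have sW : self_adjoint ip W.
  by apply: diag_self_adjoint => //; exact: bounded_seq_expRZ.
have BPC2 : PC2 ip (diag ip f (expR \o b)) by rewrite -BE; exists B, mu.
have powB s : op_pow ip (B + mu *: idfun) s = diag ip f (fun k => expR (s * b k)).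
  by rewrite BE; exact: (op_pow_diag ip_norm s sepH dimH inverse_of_id hf bb BPC2).
rewrite !powB -/W in LamE.
have PL : PC2_of ip Lam (gamma / mu).
  exact: (PC2_of_congruence ip_norm PA hf bb mu0 bmu LamE).
have [e [l [he bl PE nu0 [Q lQ]]]] := PC2_eigenbasis ip_norm sepH dimH PL.
have PPC2 : PC2 ip (diag ip e (expR \o l)) by rewrite -PE; exists Lam, (gamma / mu).
have invB : op_inv (B + mu *: idfun) = W \o W.
  apply: op_inv_eq; rewrite BE.
  have -> : W \o W = diag ip f (fun k => expR (- 1 * b k)).
    have half : - 2^-1 + - 2^-1 = - 1 :> R by lra.
    by rewrite -half; exact: diag_expR_comp.
  have -> : expR \o b = fun k => expR (1 * b k).
    by apply/funext => k; rewrite /= mul1r.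
  exact: diag_expR_inverse.
(* Insert C W = I on the left: (A + gamma I) W W = C (W (A + gamma I) W) W. *)
have ABE : AB = C \o diag ip e (expR \o l) \o W.
  rewrite /AB invB -PE LamE; apply/funext => x /=.
  by rewrite -[C (W _)]/((C \o W) _) CWE.
pose nu := gamma / mu.
pose g x := (alpha + beta)^-1 * (alpha * expR (p * x) + beta * expR (- q * x)).
pose g0 := (alpha + beta)^-1 * (alpha * nu `^ p + beta * nu `^ (- q)).
have ab0 : 0 < alpha + beta by rewrite addr_gt0.
have g0_gt0 : 0 < g0.
  by rewrite mulr_gt0 ?invr_gt0// addr_gt0// mulr_gt0// powR_gt0.
pose w k := g (l k) - g0.
have [s0 ws0] := power_mean_summable bl nu0 alpha_gt0 beta_gt0 lQ pqE.
have ws n : \sum_(k < n) `|w k| <= (alpha + beta)^-1 * s0.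
  have := ws0 n; rewrite -(ler_pM2l (x := (alpha + beta)^-1)) ?invr_gt0//.
  apply: le_trans; rewrite mulr_sumr; apply: ler_sum => k _.
  by rewrite /w /g /g0 -mulrBr normrM gtr0_norm// invr_gt0.
have bw := summable_bounded ws.
(* Stated for any inverse pair, to serve both (C, W) and the identity; D (g0 I) D' = g0 I, so both
   means have the same scalar part. *)
have meanE D D' : inverse_of D D' ->
    mean (D \o diag ip e (expR \o l) \o D') =
      (D \o diag ip e w \o D') + g0 *: idfun.
  move=> DD; have [[lD cD] [lD' cD'] DDE _] := DD.
  rewrite /mean !(op_pow_diag ip_norm _ sepH dimH DD he bl PPC2).
  apply/funext => x; rewrite !fctE/=.
  have -> : g0 *: x = D (g0 *: D' x).
    by rewrite linZ// -[D (D' x)]/((D \o D') x) DDE.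
  rewrite -(linZ lD alpha) -(linZ lD beta) -!(linD lD) -(linZ lD); congr (D _).
  apply: (onb_eq he) => k; rewrite !(ipZl, ipDl) !ip_diag//; first last.
  - exact: bounded_seq_expRZ.
  - exact: bounded_seq_expRZ.
  by rewrite /w /g /g0; ring.
have tr D D' : bounded_op D -> bounded_op D' -> self_adjoint ip D ->
    self_adjoint ip D' -> trace_class ip (D \o diag ip e w \o D').
  move=> bD bD' sD sD'.
  exact: (trace_class_conj ip_norm sepH dimH he bD bD' sD sD' ws).
have sid : self_adjoint ip (idfun : H -> H) by [].
have scaled : g0^-1 *: diag ip e w = diag ip e (fun k => g0^-1 * w k).
  apply: (diag_unique ip_norm he).
  - by apply: (@bounded_seqM _ (fun=> g0^-1)) => //; exists `|g0^-1|.
  - by apply: bounded_opZ; exact: diag_bounded.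
  - by move=> k; rewrite fctE diag_basis// scalerA.
have ws' n : \sum_(k < n) `|g0^-1 * w k| <= `|g0^-1| * ((alpha + beta)^-1 * s0).
  under eq_bigr do rewrite normrM.
  by rewrite -mulr_sumr ler_wpM2l.
have idE (T : H -> H) : idfun \o T \o idfun = T by [].
have meanP := meanE _ _ inverse_of_id; rewrite !idE in meanP.
have trP := tr _ _ bounded_op_id bounded_op_id sid sid; rewrite idE in trP.
have trAB := tr _ _ bC bW sC sW.
rewrite ABE PE (meanE _ _ CW) meanP.
split; first by exists (C \o diag ip e w \o W), g0.
have g0_neq0 : g0 != 0 by rewrite gt_eqF.
rewrite (detX_eq ip_norm trAB g0_neq0) (detX_eq ip_norm trP g0_neq0); congr (_ * _).
(* [detX] divides K by g0, so invariance is applied to the weights w_k / g0. *)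
rewrite scaled -(fredholm_det_conj ip_norm he CW sW ws') -scaled.
congr (fredholm_det ip _); apply/funext => x.
exact: (esym (linZ bC.1 g0^-1 (diag ip e w (W x)))).
Qed.
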